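(* Let $(M,g)$ be a Riemannian manifold with curvature tensor $R$, let $\sigma\neq TM$ be a distribution on $M$ of dimension $p\ge 1$ with orthogonal complement $\sigma^{\bot}$, and equip $TM$ with the Sasaki metric. Let $\sigma^h$ and $\sigma^v$ be the horizontal and vertical lifts of $\sigma$ to $TM$. Then: (1) If $\sigma^h$ is harmonic, then $\sigma$ is harmonic. (2) If $\sigma^v$ is harmonic, then $\sigma$ is harmonic and $R(\sigma,\sigma^{\bot})=0$, i.e. $R(X,Y)=0$ for all $x\in M$, $X\in\sigma(x)$, $Y\in\sigma^{\bot}(x)$. In particular, on a manifold of nonzero constant sectional curvature the vertical lift $\sigma^v$ is never harmonic.
   Context: Harmonic distributions. Let $(N,h)$ be a Riemannian manifold with Levi--Civita connection $D$, and let $\delta$ be a distribution on $N$ (a smooth subbundle of $TN$) with $h$-orthogonal complement $\delta^{\bot}$; $\top,\bot$ denote the orthogonal projections onto $\delta,\delta^{\bot}$. The distribution $\delta$ is harmonic if, as a section of the Grassmann bundle of $\dim\delta$-dimensional tangent subspaces, it is a critical point of the vertical energy functional (half the integral of the squared norm of the vertical part of its differential, over $N$ or over compact subsets). This is equivalent to the vanishing of the vertical tension field, i.e. to $\tau^V(\delta)(X,Y)=0$ for all $X\in\delta$, $Y\in\delta^{\bot}$, where $$\tau^V(\delta)(X,Y)=h\Big(\sum_{\alpha}\big((D^2X)(E_{\alpha},E_{\alpha})-2D_{E_{\alpha}}(D_{E_{\alpha}}X)^{\top}\big),Y\Big),\qquad (D^2X)(E,E)=D_ED_EX-D_{D_EE}X,$$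 $(E_\alpha)$ is a local orthonormal frame on $N$, and $X$ is extended to a local section of $\delta$ (the result does not depend on the extension or the frame). Harmonicity of $\sigma$ refers to $(N,h)=(M,g)$; harmonicity of $\sigma^h,\sigma^v$ refers to $N=TM$ with the Sasaki metric. Lifts and Sasaki metric. The Levi--Civita connection of $g$ gives the splitting $T_{\xi}TM=\mathcal H^{TM}_{\xi}\oplus\mathcal V^{TM}_{\xi}$ into horizontal and vertical subspaces, with horizontal and vertical lifts $X^h_\xi$, $X^v_\xi$ of $X\in T_xM$ to $\xi\in T_xM$. The Sasaki metric is $g_S(X^h,Y^h)=g(X,Y)$, $g_S(X^h,Y^v)=0$, $g_S(X^v,Y^v)=g(X,Y)$. The lifts of $\sigma$ are the distributions on $TM$ given by $\sigma^h(\xi)=\{X^h_\xi: X\in\sigma(x)\}$ and $\sigma^v(\xi)=\{X^v_\xi: X\in\sigma(x)\}$ for $\xi\in T_xM$. *)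

(* Defs.v *)
From HB Require Import structures.
From mathcomp Require Import all_boot all_order all_algebra.
From mathcomp Require Import all_classical all_reals all_analysis.
Import Order.TTheory GRing.Theory Num.Theory.
Import numFieldNormedType.Exports.

Set Implicit Arguments.
Unset Strict Implicit.
Unset Printing Implicit Defensive.

Local Open Scope classical_set_scope.
Local Open Scope ring_scope.

Fixpoint Ck (R : realType) (V W : normedModType R) (k : nat) (U : set V)
    (f : V -> W) : Prop :=
  match k with
  | 0%N => forall x, U x -> {for x, continuous f}
  | k'.+1 => (forall x, U x -> differentiable f x) /\
             (forall v, Ck k' U ('D_v f))
  end.

Definition smooth_on (R : realType) (V W : normedModType R) (U : set V)
  (f : V -> W) : Prop := forall k, Ck k U f.

(* Riemannian geometry on an open subset of R^n. Vectors are rows, a metric is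
   a field G of Gram matrices, vector fields are functions 'rV_n -> 'rV_n. *)
Section Local.
Variables (R : realType) (n : nat).
Implicit Types (G : 'rV[R]_n -> 'M[R]_n) (X Y : 'rV[R]_n -> 'rV[R]_n).

Definition ip (B : 'M[R]_n) (u v : 'rV[R]_n) : R := (u *m B *m v^T) 0 0.

(* christoffel G x u v is the vector w such that, for every z,
   2 <w, z> = D_u <v, z> + D_v <u, z> - D_z <u, v> for constant u, v, z. *)
Definition christoffel G (x u v : 'rV[R]_n) : 'rV[R]_n :=
  (\row_l (2^-1 * ('D_u (fun y => ip (G y) v (delta_mx 0 l)) x
                 + 'D_v (fun y => ip (G y) u (delta_mx 0 l)) x
                 - 'D_(delta_mx 0 l) (fun y => ip (G y) u v) x)))
  *m invmx (G x).

(* Levi-Civita covariant derivative of Y along X *)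
Definition cov G X Y : 'rV[R]_n -> 'rV[R]_n :=
  fun x => 'D_(X x) Y x + christoffel G x (X x) (Y x).

(* R(u,v)w = D_u D_v w - D_v D_u w for the constant (hence commuting)
   coordinate fields u, v, w; the bracket term vanishes. *)
Definition curv G (x u v w : 'rV[R]_n) : 'rV[R]_n :=
  cov G (cst u) (cov G (cst v) (cst w)) x
  - cov G (cst v) (cov G (cst u) (cst w)) x.

Definition orth (B : 'M[R]_n) (S : set 'rV[R]_n) : set 'rV[R]_n :=
  [set u | forall w, S w -> ip B u w = 0].

(* When B is positive definite and S is a subspace, the set below is a
   singleton. *)
Definition oproj (B : 'M[R]_n) (S : set 'rV[R]_n) (u : 'rV[R]_n) : 'rV[R]_n :=
  xget 0 [set s | S s /\ orth B S (u - s)].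

(* tau^V(delta)(X, Y) at x, computed with the frame E *)
Definition vertical_tension G (delta : 'rV[R]_n -> set 'rV[R]_n)
    (E : 'I_n -> 'rV[R]_n -> 'rV[R]_n) X (x Y : 'rV[R]_n) : R :=
  ip (G x)
    (\sum_a ((cov G (E a) (cov G (E a) X) x - cov G (cov G (E a) (E a)) X x)
             - 2 *: cov G (E a)
                      (fun y => oproj (G y) (delta y) (cov G (E a) X y)) x))
    Y.

End Local.

(* An atlas on a set M, modelled on R^n: chart i is meaningful on dom i, and
   chartV i is its inverse, meaningful on the image of dom i. Each point x has
   a distinguished chart base x around it; the tangent space at x is
   represented by 'rV_n, a row being the components of a tangent vector in the
   chart base x. *)
Record atlas (R : realType) (n : nat) (M : Type) := Atlas {
  idx : Type;
  dom : idx -> set M;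
  chart : idx -> M -> 'rV[R]_n;
  chartV : idx -> 'rV[R]_n -> M;
  base : M -> idx }.

Section Manifold.
Variables (R : realType) (n : nat).

Definition img (M : Type) (A : atlas R n M) (i : idx A) : set 'rV[R]_n :=
  chart i @` dom i.

Definition trans (M : Type) (A : atlas R n M) (i j : idx A) :
  'rV[R]_n -> 'rV[R]_n := chart j \o chartV i.

Record smooth_manifold (M : topologicalType) (A : atlas R n M) : Prop := {
  mfd_hausdorff : hausdorff_space M;
  mfd_second_countable : @second_countable M;
  mfd_base : forall x, dom (base A x) x;
  mfd_dom_open : forall i : idx A, open (dom i);
  mfd_img_open : forall i : idx A, open (img i);
  mfd_chartK : forall (i : idx A) x, dom i x -> chartV i (chart i x) = x;
  mfd_chart_continuous : forall (i : idx A) x,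
    dom i x -> {for x, continuous (chart i)};
  mfd_chartV_continuous : forall (i : idx A) y,
    img i y -> {for y, continuous (chartV i)};
  mfd_trans_smooth : forall i j : idx A,
    smooth_on (chart i @` (dom i `&` dom j)) (trans i j) }.

Section Tensors.
Variables (M : Type) (A : atlas R n M).

(* change of components of tangent vectors (acting on the right of rows) from
   chart i at the point of coordinates y to the chart base (chartV i y) *)
Definition to_base (i : idx A) (y : 'rV[R]_n) : 'M[R]_n :=
  'J (trans i (base A (chartV i y))) y.

(* Tensors are given by their components in the distinguished charts:
   g x is the Gram matrix of the inner product of T_x M, sigma x is a set of
   tangent vectors. The next two definitions express them in chart i. *)
Definition loc_metric (g : M -> 'M[R]_n) (i : idx A) (y : 'rV[R]_n) :
    'M[R]_n :=
  to_base i y *m g (chartV i y) *m (to_base i y)^T.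

Definition loc_dist (sigma : M -> set 'rV[R]_n) (i : idx A) (y : 'rV[R]_n) :
    set 'rV[R]_n :=
  [set u | sigma (chartV i y) (u *m to_base i y)].

Record riemannian (g : M -> 'M[R]_n) : Prop := {
  riem_sym : forall x, (g x)^T = g x;
  riem_pos : forall x u, u != 0 -> 0 < ip (g x) u u;
  riem_smooth : forall i : idx A, smooth_on (img i) (loc_metric g i) }.

(* smooth subbundle of rank p: locally spanned by the rows of a smooth field
   of p x n matrices of rank p *)
Definition smooth_distribution (p : nat) (sigma : M -> set 'rV[R]_n) : Prop :=
  forall (i : idx A) y, img i y ->
  exists (V : set 'rV[R]_n) (F : 'rV[R]_n -> 'M[R]_(p, n)),
    [/\ open V, V y, V `<=` img i, smooth_on V F &
        forall z, V z ->
          row_free (F z) /\ loc_dist sigma i z = [set u | (u <= F z)%MS]].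

(* delta is a critical point of the vertical energy: its Euler-Lagrange
   equation tau^V(delta) = 0. As tau^V depends neither on the local orthonormal
   frame E nor on the local section X of delta extending X y, all of them are
   quantified over. *)
Definition harmonic_distribution (g : M -> 'M[R]_n) (delta : M -> set 'rV[R]_n) : Prop :=
  forall (i : idx A) (V : set 'rV[R]_n)
    (E : 'I_n -> 'rV[R]_n -> 'rV[R]_n) (X : 'rV[R]_n -> 'rV[R]_n),
  open V -> V `<=` img i ->
  (forall a, smooth_on V (E a)) ->
  (forall z, V z ->
     forall a b, ip (loc_metric g i z) (E a z) (E b z) = (a == b)%:R) ->
  smooth_on V X ->
  (forall z, V z -> loc_dist delta i z (X z)) ->
  forall y, V y -> forall Y, orth (loc_metric g i y) (loc_dist delta i y) Y ->
  vertical_tension (loc_metric g i) (loc_dist delta i) E X y Y = 0.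

Definition curvature (g : M -> 'M[R]_n) (x : M) (u v w : 'rV[R]_n) :
    'rV[R]_n :=
  curv (loc_metric g (base A x)) (chart (base A x) x) u v w.

Definition sectional (g : M -> 'M[R]_n) (x : M) (u v : 'rV[R]_n) : R :=
  ip (g x) (curvature g x u v v) u
  / (ip (g x) u u * ip (g x) v v - ip (g x) u v ^+ 2).

Definition constant_sectional (g : M -> 'M[R]_n) (kappa : R) : Prop :=
  forall x (u v : 'rV[R]_n), row_free (col_mx u v) -> sectional g x u v = kappa.

(* The tangent bundle is the set M * 'rV_n; the chart of TM induced by chart i
   is (x, xi) |-> (coordinates of x, components of xi in chart i). The tangent
   space of TM at (x, xi) is thus represented by 'rV_(n + n), in the chart
   induced by base x. *)
Definition tangent_atlas : atlas R (n + n) (M * 'rV[R]_n) := {|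
  idx := idx A;
  dom := fun i => [set q | dom i q.1];
  chart := fun i q =>
    row_mx (chart i q.1)
      (q.2 *m 'J (trans (base A q.1) i) (chart (base A q.1) q.1));
  chartV := fun i z =>
    (chartV i (lsubmx z), rsubmx z *m to_base i (lsubmx z));
  base := fun q => base A q.1 |}.

(* The (symmetric) matrix of the linear map u |-> Gamma(u, xi) in the chart
   base x *)
Definition conn_mx (g : M -> 'M[R]_n) (q : M * 'rV[R]_n) : 'M[R]_n :=
  \matrix_a christoffel (loc_metric g (base A q.1)) (chart (base A q.1) q.1)
              (delta_mx 0 a) q.2.

Definition hlift (g : M -> 'M[R]_n) (q : M * 'rV[R]_n) (u : 'rV[R]_n) :
    'rV[R]_(n + n) :=
  row_mx u (- (u *m conn_mx g q)).

Definition vlift (q : M * 'rV[R]_n) (u : 'rV[R]_n) : 'rV[R]_(n + n) :=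
  row_mx 0 u.

(* The vector (a, b) of T_q TM is the sum of the horizontal lift of a and of
   the vertical lift of b + Gamma(a, xi); see sasakiP. *)
Definition sasaki (g : M -> 'M[R]_n) (q : M * 'rV[R]_n) : 'M[R]_(n + n) :=
  let K := block_mx 1%:M (conn_mx g q) 0 1%:M in
  K *m block_mx (g q.1) 0 0 (g q.1) *m K^T.

Lemma sasakiP (g : M -> 'M[R]_n) (q : M * 'rV[R]_n) (u v : 'rV[R]_n) :
  [/\ ip (sasaki g q) (hlift g q u) (hlift g q v) = ip (g q.1) u v,
      ip (sasaki g q) (hlift g q u) (vlift q v) = 0 &
      ip (sasaki g q) (vlift q u) (vlift q v) = ip (g q.1) u v].
Proof.
have hK w : hlift g q w *m block_mx 1%:M (conn_mx g q) 0 1%:M = row_mx w 0.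
  by rewrite /hlift mul_row_block !mulmx1 mulmx0 addr0 subrr.
have vK w : vlift q w *m block_mx 1%:M (conn_mx g q) 0 1%:M = row_mx 0 w.
  by rewrite /vlift mul_row_block !mul0mx mulmx0 mulmx1 addr0 add0r.
rewrite /ip /sasaki; set K := block_mx _ _ _ _ in hK vK *.
have E (D : 'M[R]_(n + n)) (a b : 'rV[R]_(n + n)) :
    a *m (K *m D *m K^T) *m b^T = (a *m K) *m D *m (b *m K)^T.
  by rewrite trmx_mul !mulmxA.
rewrite !E !hK !vK !mul_row_block !mulmx0 !mul0mx !addr0 !add0r.
rewrite !tr_row_mx !mul_row_col !trmx0 !mulmx0 !mul0mx !addr0 !add0r.
by split=> //; rewrite mxE.
Qed.

Definition hlift_dist (g : M -> 'M[R]_n) (sigma : M -> set 'rV[R]_n)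
    (q : M * 'rV[R]_n) : set 'rV[R]_(n + n) :=
  hlift g q @` sigma q.1.

Definition vlift_dist (sigma : M -> set 'rV[R]_n) (q : M * 'rV[R]_n) :
    set 'rV[R]_(n + n) :=
  vlift q @` sigma q.1.

End Tensors.
End Manifold.

(* Main.v *)
(* In the splitting of T(TM) into horizontal and vertical parts, a vector field
   of TM is a pair (f, h) of fields along TM -> M, the Sasaki metric is g + g,
   and its Levi-Civita connection at eta, in the direction (a, c), reads
     (D_a f + (R(eta, c) f + R(eta, h) a) / 2, D_a h - R(a, f) eta / 2).
   Hence at eta = 0 the vertical tension of sigma^h on (X^h, Y^h) is that of
   sigma on (X, Y), and at any eta the one of sigma^v on (X^v, Y^v) is
     tau(X, Y) - 1/4 sum_a <R(eta, X) E_a, R(eta, Y) E_a>.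
   If the latter vanishes for all eta, then eta = 0 gives tau(X, Y) = 0, and
   eta = X + Y turns the sum into - sum_a |R(X, Y) E_a|^2, whence R(X, Y) = 0.
   In coordinates, the connection formula is checked by showing that its right
   hand side is symmetric and metric, and the expression of the Sasaki metric in
   an arbitrary chart rests on the transformation law of Christoffel symbols. *)
Require Import Defs.
From HB Require Import structures.
From mathcomp Require Import all_boot all_order all_algebra.
From mathcomp Require Import all_classical all_reals all_analysis.
From mathcomp Require Import ring lra.
Import Order.TTheory GRing.Theory Num.Theory.
Import numFieldNormedType.Exports.

Set Implicit Arguments.
Unset Strict Implicit.
Unset Printing Implicit Defensive.

Local Open Scope classical_set_scope.
Local Open Scope ring_scope.

(** * Directional derivatives *)

(** [harmonic_distribution] quantifies over all local orthonormal frames and sections, so no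
    invariance of the tension has to be proved: on TM it is tested only on the horizontal and
    vertical lifts of a frame of M and on the lift of a section. For R(X, Y) = 0 a frame of M must
    be supplied, hence the smooth orthonormalisation. The constant 1/4 is a product of two halves.
    D_{E_a} X^v has horizontal part R(eta, X) E_a / 2, which the projection onto sigma^v discards,
    but which the second derivative along E_a sends to a vertical part through -R(E_a, .) eta / 2.
    For sigma^h, the corrections to the horizontal part contain R(eta, .) and vanish on the zero
    section. The obstacle is that tensors on TM are given in the distinguished chart of each point,
    which need not vary continuously with it. Metric and lifts must be rewritten in one fixed chart.
    The Jacobian of a transition map of TM contains a Hessian, and this Hessian is exactly the
    inhomogeneous term in the transformation law of Christoffel symbols, so vertical parts transform
    like tangent vectors of M. *)

Section DirectionalDerivatives.
Variables (R : realType) (V W : normedModType R).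
Implicit Types (x v : V).

Lemma is_derive_mxP m n (M : V -> 'M[R]_(m, n)) x v (dM : 'M[R]_(m, n)) :
  is_derive x v M dM <->
  forall i j, is_derive x v (fun y => M y i j) (dM i j).
Proof.
split=> [[dMx <-] i j|h].
  rewrite derive_mx// mxE.
  by apply: derivableP; move/derivable_mxP: dMx.
have dMx : derivable M x v by apply/derivable_mxP => i j; case: (h i j).
split=> //; rewrite derive_mx//; apply/matrixP => i j; rewrite mxE.
by case: (h i j).
Qed.

Lemma is_derive_fsum (I : Type) (r : seq I) (h : I -> V -> W) x v
    (dh : I -> W) : (forall i, is_derive x v (h i) (dh i)) ->
  is_derive x v (fun y => \sum_(i <- r) h i y) (\sum_(i <- r) dh i).
Proof.
move=> hd; rewrite (_ : (fun y => _) = \sum_(i <- r) h i); last first.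
  by apply/funext => y; rewrite fct_sumE.
by elim/big_ind2 : _ => // [|] *; [exact: is_derive_cst|exact: is_deriveD].
Qed.

Lemma is_derive_scale (k : V -> R) (f : V -> W) x v dk df :
  is_derive x v k dk -> is_derive x v f df ->
  is_derive x v (fun y => k y *: f y) (dk *: f x + k x *: df).
Proof.
move=> [kd <-] [fd <-].
suff H : (fun h => h^-1 *: (((fun y => k y *: f y) \o shift x) (h *: v)
   - k x *: f x)) @ 0^' --> 'D_v k x *: f x + k x *: 'D_v f x.
  split; first by apply/cvg_ex; eexists; exact: H.
  exact: cvg_lim H.
evar (fg : R -> W); rewrite [X in X @ _](_ : _ = fg) /=; last first.
  rewrite funeqE => h.
  have -> : k (h *: v + x) *: f (h *: v + x) - k x *: f x =
     (k (h *: v + x) - k x) *: f x + k (h *: v + x) *: (f (h *: v + x) - f x).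
    by rewrite scalerBr scalerBl [RHS]addrC subrKA.
  rewrite scalerDr [X in X + _]scalerA [X in _ + X]scalerA.
  by rewrite [X in _ + X *: _]mulrC -[X in _ + X]scalerA /fg.
apply: cvgD; first by apply: cvgZr_tmp; exact: kd.
apply: cvg_comp2 (@scale_continuous _ _ (_, _)) => /=; last exact: fd.
(* Directional derivability makes [k] continuous along the line through [x] in the direction [v],
   which is all that this limit uses. *)
suff : {for 0, continuous (fun h : R => k (h *: v + x))}.
  by move=> /continuous_withinNx; rewrite scale0r add0r.
exact/differentiable_continuous/derivable1_diffP/(derivable1P _ _ _).1.
Qed.

Lemma differentiable_is_derive (f : V -> W) x v :
  differentiable f x -> is_derive x v f ('D_v f x).
Proof. by move=> /diff_derivable df; apply: derivableP. Qed.

(** The difference quotient of [f \o L] in the direction [v] is literally that of [f] in the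
    direction [L v], so directional derivability transfers as it stands. *)
Lemma is_derive_precomp (V' : normedModType R) (L : {linear V -> V'})
    (f : V' -> W) x v df :
  is_derive (L x) (L v) f df -> is_derive x v (f \o L) df.
Proof.
have E : (fun h : R => h^-1 *: ((f \o L \o shift x) (h *: v) - (f \o L) x)) =
         (fun h : R => h^-1 *: ((f \o shift (L x)) (h *: L v) - f (L x))).
  by apply/funext => h; rewrite /= linearP.
move=> [fd <-]; split; first by rewrite /derivable E.
by rewrite /derive E.
Qed.

Lemma is_derive_lin (f : V -> W) x a u v : differentiable f x ->
  'D_(a *: u + v) f x = a *: 'D_u f x + 'D_v f x.
Proof. by move=> df; rewrite !deriveE// linearP. Qed.

Lemma differentiable_mxP m n (M : V -> 'M[R]_(m, n)) x :
  differentiable M x <-> forall i j, differentiable (fun y => M y i j) x.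
Proof.
split=> [dM i j|h].
  exact: (differentiable_comp dM (differentiable_coord _ _ _)).
rewrite (_ : M = \sum_(i < m) \sum_(j < n)
  (fun y => M y i j *: delta_mx i j)); last first.
  apply/funext => y; rewrite fct_sumE [LHS]matrix_sum_delta.
  by apply: eq_bigr => i _; rewrite fct_sumE.
by do 2 (apply: differentiable_sum => ?); apply: differentiableZl.
Qed.

(** Differentiability depends on the germ only: ['d f x] is also a first-order approximation of [g],
    and uniqueness of the differential identifies it with ['d g x]. *)
Lemma differentiable_ext (f g : V -> W) x :
  (\near x, f x = g x) -> differentiable f x -> differentiable g x.
Proof.
move=> fg df; apply/diff_locallyP.
have fgx : f x = g x := nbhs_singleton fg.
have H : continuous ('d f x) /\ g \o shift x = cst (g x) + 'd f x +o_ 0 id.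
  split; first by apply: diff_continuous.
  apply/eqaddoP => e e0.
  have /eqaddoP/(_ e e0) := diff_locally df.
  have fg0 : \forall h \near 0, f (h + x) = g (h + x).
    move: fg; rewrite (near_shift 0 x); apply: filterS => h /=.
    by rewrite subr0.
  apply: filter_app2 fg0 => //=; near=> h => E.
  rewrite -![(_ + _ : _ -> _) _]/(_ + _) -![(- _ : _ -> _) _]/(- _) /cst /=.
  by rewrite E fgx.
by have -> : 'd g x = 'd f x :> (V -> W) by case: H; exact: diff_unique.
Unshelve. all: by end_near. Qed.

Lemma is_derive_chain (V' : normedModType R) (f : V' -> W) (phi : V -> V')
    x v : differentiable phi x -> differentiable f (phi x) ->
  is_derive x v (f \o phi) ('D_('D_v phi x) f (phi x)).
Proof.
move=> dphi df; have dc := differentiable_comp dphi df.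
by split; [exact: diff_derivable|rewrite !deriveE// diff_comp].
Qed.

End DirectionalDerivatives.

(** * Leibniz rule for families of bilinear maps *)

Section BilinearFamilies.
Variables (R : realType) (V W : normedModType R) (m k : nat).

Definition bilin (B : 'rV[R]_m -> 'rV[R]_k -> W) : Prop :=
  (forall a u u' v, B (a *: u + u') v = a *: B u v + B u' v) /\
  (forall a u v v', B u (a *: v + v') = a *: B u v + B u v').

Lemma bilin_expand B u v : bilin B ->
  B u v = \sum_(i < m) \sum_(j < k)
    (u 0 i * v 0 j) *: B (delta_mx 0 i) (delta_mx 0 j).
Proof.
move=> [Bl Br].
have B0l v' : B 0 v' = 0.
  by have := Bl (-1) 0 0 v'; rewrite scaleN1r scaleN1r oppr0 addr0 addNr.
have B0r u' : B u' 0 = 0.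
  by have := Br (-1) u' 0 0; rewrite scaleN1r scaleN1r oppr0 addr0 addNr.
have BS u' : B u' v = \sum_(j < k) v 0 j *: B u' (delta_mx 0 j).
  rewrite {1}[v]row_sum_delta; elim/big_rec2 : _ => // i y1 y2 _ <-.
  exact: Br.
rewrite {1}[u]row_sum_delta.
transitivity (\sum_(i < m) u 0 i *: B (delta_mx 0 i) v).
  by elim/big_rec2 : _ => // i y1 y2 _ <-; exact: Bl.
apply: eq_bigr => i _; rewrite BS scaler_sumr.
by apply: eq_bigr => j _; rewrite scalerA.
Qed.

(** Near [x] the expression is a finite sum of scalar coefficients times values of [B] at basis
    vectors, so the rule for constant arguments and the product rule suffice. The three terms
    differentiate [B], [f] and [h] in turn. *)
Lemma is_derive_bilin (B : V -> 'rV[R]_m -> 'rV[R]_k -> W)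
    (f : V -> 'rV[R]_m) (h : V -> 'rV[R]_k) (x v : V) df dh :
  (\near x, bilin (B x)) ->
  (forall a b, derivable (fun y => B y a b) x v) ->
  is_derive x v f df -> is_derive x v h dh ->
  is_derive x v (fun y => B y (f y) (h y))
    ('D_v (fun y => B y (f x) (h x)) x + B x df (h x) + B x (f x) dh).
Proof.
move=> Bb Bd /is_derive_mxP fd /is_derive_mxP hd.
have Bx : bilin (B x) := nbhs_singleton Bb.
pose S (c : 'I_m -> 'I_k -> R) (D : 'rV[R]_m -> 'rV[R]_k -> W) :=
  \sum_(i < m) \sum_(j < k) c i j *: D (delta_mx 0 i) (delta_mx 0 j).
have SD c (dc : 'I_m -> 'I_k -> R) : (forall i j, is_derive x v (c ^~ i ^~ j) (dc i j)) ->
    is_derive x v (fun y => S (c y) (B y))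
      (S dc (B x) + S (c x) (fun a b => 'D_v (fun y => B y a b) x)).
  move=> cd; rewrite /S -big_split; apply: is_derive_fsum => i /=.
  rewrite -big_split; apply: is_derive_fsum => j /=.
  by apply: is_derive_scale => //; apply: derivableP.
apply: (@near_eq_is_derive _ _ _ (fun y => S (fun i j => f y 0 i * h y 0 j) (B y))).
  by apply: filterS Bb => y By; rewrite /S -bilin_expand.
have D1 := SD (fun y i j => f y 0 i * h y 0 j) _
  (fun i j => is_deriveM (fd 0 i) (hd 0 j)).
apply: (is_derive_eq D1).
rewrite addrC -addrA; congr (_ + _).
  (* The derivative of [B] at frozen arguments is identified by expanding it with constant
     coefficients. *)
  suff : is_derive x v (fun y => B y (f x) (h x))
      (S (fun i j => f x 0 i * h x 0 j) (fun a b => 'D_v (fun y => B y a b) x)).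
    by case=> _ ->.
  apply: (@near_eq_is_derive _ _ _ (fun y => S (fun i j => f x 0 i * h x 0 j) (B y))).
    by apply: filterS Bb => y By; rewrite /S -bilin_expand.
  have D2 := SD (fun _ i j => f x 0 i * h x 0 j) _
    (fun i j => is_derive_cst (f x 0 i * h x 0 j) x v).
  apply: (is_derive_eq D2).
  rewrite [X in X + _]big1 ?add0r// => i _; rewrite big1// => j _.
  by rewrite scale0r.
rewrite [B x df _]bilin_expand// [B x _ dh]bilin_expand// -big_split.
apply: eq_bigr => i _; rewrite -big_split; apply: eq_bigr => j _ /=.
by rewrite -scalerDl addrC [h x 0 j *: _]mulrC.
Unshelve. all: by end_near. Qed.

End BilinearFamilies.

(** * Symmetry of second derivatives *)

Section Schwarz.
Variables (R : realType) (V : normedModType R).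

Lemma mean_value_line (f : V -> R) (x v : V) (s : R) : 0 < s ->
  (forall t, 0 <= t <= s -> differentiable f (x + t *: v)) ->
  exists2 t, 0 < t < s & f (x + s *: v) - f x = s * 'D_v f (x + t *: v).
Proof.
move=> s0 df.
have dl t : 0 <= t <= s ->
    is_derive t 1 (fun r : R => f (x + r *: v)) ('D_v f (x + t *: v)).
  move=> /df dft; apply: is_derive_eq.
    apply: (is_derive_chain (phi := fun r : R => x + r *: v)) => //.
  congr ('D_ _ f _).
  have : is_derive t 1 (fun r : R => x + r *: v) (0 + (1 *: v + t *: 0)).
    apply: is_deriveD; apply: is_derive_scale.
  by case=> _ ->; rewrite add0r scaler0 addr0 scale1r.
have [||c] := @MVT R (fun r => f (x + r *: v)) (fun t => 'D_v f (x + t *: v)) 0 s s0.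
- by move=> t; rewrite in_itv/= => /andP[t0 ts]; apply: dl; rewrite !ltW.
- apply: derivable_within_continuous => t; rewrite in_itv/= => /dl.
  by case.
- rewrite in_itv/= subr0 scale0r addr0 => cI ->; exists c => //.
  by rewrite mulrC.
Qed.

(** The mean value theorem is used twice: for the increment [f (y + s *: u) - f y] in the direction
    [v], then for ['D_v f] in the direction [u]. *)
Lemma second_difference (f : V -> R) (x u v : V) (s : R) : 0 < s ->
  (forall a b, 0 <= a <= s -> 0 <= b <= s ->
     differentiable f (x + a *: u + b *: v) /\
     differentiable ('D_v f) (x + a *: u + b *: v)) ->
  exists a b, [/\ 0 < a < s, 0 < b < s &
    f (x + s *: u + s *: v) - f (x + s *: v) - (f (x + s *: u) - f x) =
      s ^+ 2 * 'D_u ('D_v f) (x + a *: u + b *: v)].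
Proof.
move=> s0 H.
pose g y := f (y + s *: u) - f y.
have s0s : 0 <= s <= s by rewrite lexx ltW.
have z0s : 0 <= (0 : R) <= s by rewrite lexx ltW.
have dgd b : 0 <= b <= s -> differentiable g (x + b *: v) /\
   'D_v g (x + b *: v) = 'D_v f (x + s *: u + b *: v) - 'D_v f (x + b *: v).
  move=> bs.
  have d1 : differentiable f ((x + b *: v) + s *: u).
    by rewrite addrAC; have [] := H _ _ s0s bs.
  have d0 : differentiable f (x + b *: v).
    by have [] := H _ _ z0s bs; rewrite scale0r addr0.
  have dsh : differentiable (fun y : V => y + s *: u) (x + b *: v).
    exact: differentiableD.
  have dcc : differentiable (fun y => f (y + s *: u)) (x + b *: v).
    exact: (@differentiable_comp _ _ _ _ (fun y : V => y + s *: u) f).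
  split; first exact: differentiableB.
  rewrite deriveB; try exact: diff_derivable.
  congr (_ - _).
  rewrite [x + s *: u + _]addrAC.
  have [_ ->] := is_derive_chain v dsh d1.
  congr ('D_ _ f _).
  have : is_derive (x + b *: v) v (fun y => y + s *: u) (v + 0).
    exact: is_deriveD.
  by case=> _ ->; rewrite addr0.
have [b bs E] := mean_value_line s0 (fun t ht => (dgd t ht).1).
have bs' : 0 <= b <= s by case/andP: bs => *; rewrite !ltW.
have [|a as_ E'] := @mean_value_line ('D_v f) (x + b *: v) u s s0.
  by move=> a has; rewrite addrAC; have [] := H _ _ has bs'.
exists a, b; split; [exact: as_|exact: bs|].
rewrite (addrAC x (b *: v) (s *: u)) (addrAC x (b *: v) (a *: u)) in E'.
move: E; rewrite (dgd _ bs').2 E' mulrA -expr2 /g.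
by rewrite (addrAC x (s *: v) (s *: u)) opprB addrA.
Qed.

(** If the values differed, continuity would keep [F] and [G] near [x] within half of their
    distance, and no two nearby points could satisfy [F y = G z]. *)
Lemma continuous_eq_of_close (F G : V -> R) (U : set V) (x : V) :
  {for x, continuous F} -> {for x, continuous G} -> open U -> U x ->
  (forall e, 0 < e -> (forall y, `|y - x| < e -> U y) ->
     exists y z, [/\ `|y - x| < e, `|z - x| < e & F y = G z]) ->
  F x = G x.
Proof.
move=> cF cG oU Ux H; apply/eqP; rewrite -subr_eq0 -normr_le0 leNgt.
apply/negP => n0.
have e0 : 0 < `|F x - G x| / 2 by rewrite divr_gt0.
move/cvgrPdist_lt: cF => /(_ _ e0) NF; move/cvgrPdist_lt: cG => /(_ _ e0) NG.
have NU : nbhs x U by exact: open_nbhs_nbhs.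
pose A := [set t | `|F x - F t| < `|F x - G x| / 2].
pose B := [set t | `|G x - G t| < `|F x - G x| / 2].
have NW : nbhs x (U `&` (A `&` B)).
  by apply: filterI => //; exact: filterI.
move/nbhs_ballP : NW => [e /= e_gt0 He].
have {}He y : `|y - x| < e -> (U `&` (A `&` B)) y.
  by move=> yx; apply: He; rewrite -ball_normE /= distrC.
have [|y [z [yx zx E]]] := H e e_gt0; first by move=> y /He[].
have [_ [/= H1 _]] := He _ yx; have [_ [_ /= H2]] := He _ zx.
have := ltrD H1 H2; rewrite -splitr E [X in _ + X]distrC ltNge => /negP; apply.
by rewrite (le_trans _ (ler_normD _ _))// subrKA.
Qed.

(** The second difference is symmetric in [u] and [v], and equals [s ^+ 2] times either mixed
    derivative at some point near [x]; continuity of both mixed derivatives gives equality at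
    [x]. *)
Lemma derive_swap (f : V -> R) (U : set V) (x u v : V) :
  open U -> U x -> smooth_on U f -> 'D_u ('D_v f) x = 'D_v ('D_u f) x.
Proof.
move=> oU Ux fs.
have fd y : U y -> differentiable f y by move=> Uy; case: (fs 1%N) => + _; exact.
have fdd w y : U y -> differentiable ('D_w f) y.
  by move=> Uy; case: (fs 2%N) => _ /(_ w)[+ _]; exact.
have cont w z : {for x, continuous ('D_w ('D_z f))}.
  by case: (fs 2%N) => _ /(_ z)[_ /(_ w)]; exact.
apply: (continuous_eq_of_close (cont u v) (cont v u) oU Ux) => e e_gt0 He.
(* With this scale the parallelogram on [s *: u] and [s *: v] stays within distance [e] of [x]; the
   summand 1 keeps the denominator positive when [u] and [v] are 0. *)
pose s := e / (`|u| + `|v| + 1).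
have d0 : 0 < `|u| + `|v| + 1 by rewrite ltr_wpDl ?addr_ge0.
have s0 : 0 < s by rewrite divr_gt0.
have close c d : 0 <= c <= s -> 0 <= d <= s -> `|(x + c *: u + d *: v) - x| < e.
  move=> /andP[c0 cs] /andP[dd0 ds].
  rewrite (_ : x + c *: u + d *: v - x = c *: u + d *: v); last first.
    by rewrite -(addrA x) [x + _]addrC addrK.
  rewrite (le_lt_trans (ler_normD _ _))// !normrZ !ger0_norm//.
  rewrite (@le_lt_trans _ _ (s * (`|u| + `|v|)))//.
    by rewrite mulrDr lerD// ler_wpM2r.
  by rewrite /s mulrAC ltr_pdivrMr// ltr_pM2l// ltrDl.
have [|c1 [d1 [c1s d1s E1]]] := @second_difference f x u v s s0.
  move=> c d cs ds; have Uy := He _ (close _ _ cs ds).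
  by split; [exact: fd|exact: fdd].
have [|c2 [d2 [c2s d2s E2]]] := @second_difference f x v u s s0.
  move=> c d cs ds; rewrite addrAC; have Uy := He _ (close _ _ ds cs).
  by split; [exact: fd|exact: fdd].
have wk c : 0 < c < s -> 0 <= c <= s by case/andP => *; rewrite !ltW.
exists (x + c1 *: u + d1 *: v), (x + d2 *: u + c2 *: v).
split; [exact: close (wk _ c1s) (wk _ d1s)|exact: close (wk _ d2s) (wk _ c2s)|].
apply: (mulfI (lt0r_neq0 (exprn_gt0 2 s0))).
rewrite -E1 (addrAC x (d2 *: u)) -E2 (addrAC x (s *: v)).
by rewrite !opprB addrACA [RHS]addrACA; congr (_ + _); rewrite addrC.
Qed.

End Schwarz.

(** * Smooth functions *)

Section Smoothness.
Variables (R : realType) (V : normedModType R) (U : set V).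
Hypothesis oU : open U.

Section General.
Variable (W : normedModType R).
Implicit Types f g : V -> W.

Lemma open_near_eq f g x : (forall y, U y -> f y = g y) -> U x ->
  \near x, f x = g x.
Proof. by move=> fg Ux; apply: filterS (open_nbhs_nbhs (conj oU Ux)). Qed.

(** Formulas for derivatives hold on [U] only, while [Ck] recurses on ['D_v f] as a function on the
    whole space. On an open set the one may replace the other. *)
Lemma Ck_ext k f g : (forall y, U y -> f y = g y) -> Ck k U f -> Ck k U g.
Proof.
elim: k f g => [|k IH] f g fg /=.
  move=> cf x Ux; rewrite /prop_for /continuous_at -(fg _ Ux).
  apply: cvg_trans (cf x Ux); apply: near_eq_cvg.
  by apply: open_near_eq Ux => y Uy; rewrite fg.
move=> [df dk]; split.
  by move=> x Ux; apply: differentiable_ext (df x Ux); exact: open_near_eq.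
move=> v; apply: IH (dk v) => y Uy.
by apply: near_eq_derive; exact: open_near_eq.
Qed.

Lemma CkW k f : Ck k.+1 U f -> Ck k U f.
Proof.
elim: k f => [|k IH] f.
  by move=> [df _] x Ux; apply: differentiable_continuous; exact: df.
by move=> [df dk]; split=> // v; apply: IH; exact: dk.
Qed.

Lemma smooth_differentiable f x : smooth_on U f -> U x -> differentiable f x.
Proof. by move=> /(_ 1%N)[+ _]; exact. Qed.

Lemma smooth_derive f v : smooth_on U f -> smooth_on U ('D_v f).
Proof. by move=> fs k; have [_] := fs k.+1; exact. Qed.

Lemma smooth_ext f g : (forall y, U y -> f y = g y) ->
  smooth_on U f -> smooth_on U g.
Proof. by move=> fg fs k; apply: Ck_ext fg _; exact: fs. Qed.

Lemma Ck_cst k (c : W) : Ck k U (cst c).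
Proof.
elim: k c => [|k IH] c /=; first by move=> x _; exact: cst_continuous.
split=> [x _|v]; first exact: differentiable_cst.
by apply: (@Ck_ext _ (cst 0)) => // y _; rewrite derive_cst.
Qed.

Lemma smooth_cst (c : W) : smooth_on U (cst c).
Proof. by move=> k; exact: Ck_cst. Qed.

Lemma CkD k f g : Ck k U f -> Ck k U g -> Ck k U (fun y => f y + g y).
Proof.
elim: k f g => [|k IH] f g /=.
  by move=> cf cg x Ux; apply: continuousD; [exact: cf|exact: cg].
move=> [df dfk] [dg dgk]; split=> [x Ux|v].
  by apply: differentiableD; [exact: df|exact: dg].
apply: (@Ck_ext _ (fun y => 'D_v f y + 'D_v g y)); last exact: IH.
by move=> y Uy; rewrite deriveD//; apply: diff_derivable; [exact: df|exact: dg].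
Qed.

Lemma smoothD f g : smooth_on U f -> smooth_on U g ->
  smooth_on U (fun y => f y + g y).
Proof. by move=> fs gs k; exact: CkD. Qed.

Lemma smooth_sum (I : Type) (r : seq I) (P : pred I) (f : I -> V -> W) :
  (forall i, P i -> smooth_on U (f i)) ->
  smooth_on U (fun y => \sum_(i <- r | P i) f i y).
Proof.
move=> fs; elim: r => [|i r IH].
  by apply: (@smooth_ext (cst 0)) => [y _|]; [rewrite big_nil|exact: smooth_cst].
apply: (@smooth_ext (fun y => (if P i then f i y else 0) +
   \sum_(j <- r | P j) f j y)).
  by move=> y _; rewrite big_cons; case: ifP => // _; rewrite add0r.
by apply: smoothD => //; case Pi: (P i); [exact: fs|exact: smooth_cst].
Qed.

End General.

Lemma CkM k (f g : V -> R) : Ck k U f -> Ck k U g -> Ck k U (fun y => f y * g y).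
Proof.
elim: k f g => [|k IH] f g.
  by move=> cf cg x Ux; apply: continuousM; [exact: cf|exact: cg].
move=> fk gk; have [df dfk] := fk; have [dg dgk] := gk; split=> [x Ux|v].
  by apply: differentiableM; [exact: df|exact: dg].
apply: (@Ck_ext _ _ (fun y => f y * 'D_v g y + g y * 'D_v f y)); last first.
  have fk' := CkW fk; have gk' := CkW gk.
  by apply: CkD; apply: IH => //; [exact: dgk|exact: dfk].
by move=> y Uy; rewrite deriveM//; apply: diff_derivable; [exact: df|exact: dg].
Qed.

Lemma smoothM (f g : V -> R) : smooth_on U f -> smooth_on U g ->
  smooth_on U (fun y => f y * g y).
Proof. by move=> fs gs k; exact: CkM. Qed.

Lemma smooth_prod (I : Type) (r : seq I) (P : pred I) (f : I -> V -> R) :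
  (forall i, P i -> smooth_on U (f i)) ->
  smooth_on U (fun y => \prod_(i <- r | P i) f i y).
Proof.
move=> fs; elim: r => [|i r IH].
  by apply: (@smooth_ext _ (fun=> 1 : R)) => [y _|]; [rewrite big_nil|exact: smooth_cst].
apply: (@smooth_ext _ (fun y => (if P i then f i y else 1) *
   \prod_(j <- r | P j) f j y)).
  by move=> y _; rewrite big_cons; case: ifP => // _; rewrite mul1r.
by apply: smoothM => //; case Pi: (P i); [exact: fs|exact: smooth_cst].
Qed.

(** Induction on the order: the derivative is a product of two copies of [f^-1], a constant and a
    derivative of [f], so class k of the inverse gives class k + 1. *)
Lemma smooth_inv (f : V -> R) : smooth_on U f -> (forall y, U y -> f y != 0) ->
  smooth_on U (fun y => (f y)^-1).
Proof.
move=> fs f0; elim=> [|k IH].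
  move=> x Ux; apply: differentiable_continuous; apply: differentiableV.
    exact: smooth_differentiable fs Ux.
  exact: f0.
split=> [x Ux|v].
  by apply: differentiableV; [exact: smooth_differentiable fs Ux|exact: f0].
apply: (@Ck_ext _ _ (fun y => (-1 * ((f y)^-1 * (f y)^-1)) * 'D_v f y)).
  move=> y Uy; rewrite deriveV ?f0//; last first.
    exact/diff_derivable/(smooth_differentiable fs Uy).
  by rewrite mulN1r expr2 invfM.
apply: CkM; last by have [_] := fs k.+1; exact.
by apply: CkM; [exact: Ck_cst|exact: CkM].
Qed.

(** The derivative is written with the third power of the function itself, so that the induction
    proving its smoothness closes. *)
Lemma differentiable_rsqrt (f : V -> R) x : differentiable f x -> 0 < f x ->
  differentiable (fun y => (Num.sqrt (f y))^-1) x /\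
  forall v, 'D_v (fun y => (Num.sqrt (f y))^-1) x =
    - 2^-1 * ((Num.sqrt (f x))^-1 ^+ 3) * 'D_v f x.
Proof.
move=> df f0.
have ds : differentiable (@Num.sqrt R) (f x).
  by apply/derivable1_diffP; case: (is_derive1_sqrt f0).
have dc : differentiable (fun y => Num.sqrt (f y)) x.
  exact: (differentiable_comp df ds).
have s0 : Num.sqrt (f x) != 0 by rewrite gt_eqF// sqrtr_gt0.
split=> [|v]; first exact: differentiableV.
rewrite deriveV//; last exact: diff_derivable.
have -> : 'D_v (fun y => Num.sqrt (f y)) x = 'D_v f x * (2 * Num.sqrt (f x))^-1.
  rewrite deriveE// (diff_comp df ds) /= diff1E// -deriveE//.
  by rewrite derive1E; have [_ ->] := is_derive1_sqrt f0.
by rewrite /GRing.scale /=; field.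
Qed.

Lemma smooth_rsqrt (f : V -> R) : smooth_on U f -> (forall y, U y -> 0 < f y) ->
  smooth_on U (fun y => (Num.sqrt (f y))^-1).
Proof.
move=> fs f0.
have d y : U y -> _ := fun Uy =>
  differentiable_rsqrt (smooth_differentiable fs Uy) (f0 y Uy).
elim=> [|k IH].
  by move=> x Ux; apply: differentiable_continuous; have [] := d x Ux.
split=> [x Ux|v]; first by have [] := d x Ux.
apply: (@Ck_ext _ _ (fun y => (- 2^-1 * ((Num.sqrt (f y))^-1 *
   ((Num.sqrt (f y))^-1 * (Num.sqrt (f y))^-1))) * 'D_v f y)).
  by move=> y Uy; have [_ ->] := d y Uy; rewrite 2!exprS expr1.
apply: CkM; last by have [_] := fs k.+1; exact.
by apply: CkM; [exact: Ck_cst|do 2?apply: CkM].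
Qed.

Lemma Ck_mxP k m n (M : V -> 'M[R]_(m, n)) :
  Ck k U M <-> forall i j, Ck k U (fun y => M y i j).
Proof.
elim: k M => [|k IH] M.
  split=> [cM i j x Ux|cM x Ux].
    apply: (@continuous_comp _ _ _ M (fun N : 'M[R]_(m, n) => N i j)).
      exact: cM.
    exact: coord_continuous.
  rewrite (_ : M = \sum_(i < m) \sum_(j < n)
    (fun y => M y i j *: delta_mx i j)); last first.
    apply/funext => y; rewrite fct_sumE [LHS]matrix_sum_delta.
    by apply: eq_bigr => i _; rewrite fct_sumE.
  elim/big_ind : _ => [|f g cf cg|i _]; [exact: cst_continuous|exact: continuousD|].
  elim/big_ind : _ => [|f g cf cg|j _]; [exact: cst_continuous|exact: continuousD|].
  by apply: cvgZr_tmp; exact: cM.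
have E (v : V) i j : (forall x, U x -> differentiable M x) ->
    forall y, U y -> 'D_v M y i j = 'D_v (fun y => M y i j) y.
  by move=> dM y Uy; rewrite derive_mx ?mxE//; exact/diff_derivable/dM.
split=> [[dM dMk] i j|dM].
  split=> [x Ux|v]; first by move/differentiable_mxP: (dM x Ux).
  by apply: (Ck_ext (E v i j dM)); move/IH: (dMk v).
have dM' x : U x -> differentiable M x.
  by move=> Ux; apply/differentiable_mxP => i j; have [+ _] := dM i j; exact.
split=> // v; apply/IH => i j.
have [_ /(_ v)] := dM i j; apply: Ck_ext => y Uy.
by rewrite E.
Qed.

Lemma smooth_mxP m n (M : V -> 'M[R]_(m, n)) :
  smooth_on U M <-> forall i j, smooth_on U (fun y => M y i j).
Proof.
split=> [Ms i j k|Ms k]; last by apply/Ck_mxP => i j; exact: Ms.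
by move/Ck_mxP: (Ms k).
Qed.

Lemma smooth_mulmx m n p (M : V -> 'M[R]_(m, n)) (N : V -> 'M[R]_(n, p)) :
  smooth_on U M -> smooth_on U N -> smooth_on U (fun y => M y *m N y).
Proof.
move=> /smooth_mxP Ms /smooth_mxP Ns; apply/smooth_mxP => i j.
apply: (@smooth_ext _ (fun y => \sum_l M y i l * N y l j)) => [y _|].
  by rewrite mxE.
by apply: smooth_sum => l _; exact: smoothM.
Qed.

Lemma smooth_scale m n (c : V -> R) (M : V -> 'M[R]_(m, n)) :
  smooth_on U c -> smooth_on U M -> smooth_on U (fun y => c y *: M y).
Proof.
move=> cs /smooth_mxP Ms; apply/smooth_mxP => i j.
apply: (@smooth_ext _ (fun y => c y * M y i j)) => [y _|]; first by rewrite mxE.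
exact: smoothM.
Qed.

Lemma smooth_trmx m n (M : V -> 'M[R]_(m, n)) :
  smooth_on U M -> smooth_on U (fun y => (M y)^T).
Proof.
move=> /smooth_mxP Ms; apply/smooth_mxP => i j.
by apply: smooth_ext (Ms j i) => y _; rewrite mxE.
Qed.

Lemma smoothN m n (M : V -> 'M[R]_(m, n)) :
  smooth_on U M -> smooth_on U (fun y => - M y).
Proof.
move=> Ms; apply: (@smooth_ext _ (fun y => (-1) *: M y)) => [y _|].
  by rewrite scaleN1r.
by apply: smooth_scale => //; exact: smooth_cst.
Qed.

Lemma smooth_row_mx m n p (M : V -> 'M[R]_(m, n)) (N : V -> 'M[R]_(m, p)) :
  smooth_on U M -> smooth_on U N -> smooth_on U (fun y => row_mx (M y) (N y)).
Proof.
move=> /smooth_mxP Ms /smooth_mxP Ns; apply/smooth_mxP => i j.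
case: (split_ordP j) => l ->.
  by apply: smooth_ext (Ms i l) => y _; rewrite row_mxEl.
by apply: smooth_ext (Ns i l) => y _; rewrite row_mxEr.
Qed.

Lemma smooth_det n (M : V -> 'M[R]_n) :
  smooth_on U M -> smooth_on U (fun y => \det (M y)).
Proof.
move=> /smooth_mxP Ms; apply: smooth_sum => s _.
by apply: smoothM; [exact: smooth_cst|apply: smooth_prod].
Qed.

(** By Cramer's rule the inverse is the adjugate divided by a determinant that does not vanish on
    [U]. *)
Lemma smooth_invmx n (M : V -> 'M[R]_n) :
  smooth_on U M -> (forall y, U y -> M y \in unitmx) ->
  smooth_on U (fun y => invmx (M y)).
Proof.
move=> Ms Mu.
apply: (@smooth_ext _ (fun y => (\det (M y))^-1 *: \adj (M y))) => [y Uy|].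
  by rewrite /invmx Mu.
apply: smooth_scale.
  apply: smooth_inv; first exact: smooth_det.
  by move=> y /Mu; rewrite unitmxE unitfE.
apply/smooth_mxP => i j.
apply: (@smooth_ext _ (fun y => (-1) ^+ (j + i) * \det (row' j (col' i (M y)))))
  => [y _|]; first by rewrite mxE.
apply: smoothM; [exact: smooth_cst|apply: smooth_det].
move/smooth_mxP: Ms => Ms; apply/smooth_mxP => a b.
by apply: smooth_ext (Ms (lift j a) (lift i b)) => y _; rewrite !mxE.
Qed.

End Smoothness.

Lemma smooth_precomp (R : realType) (V V' W : normedModType R) (U : set V')
    (L : {linear V -> V'}) (f : V' -> W) :
  open U -> continuous L -> smooth_on U f -> smooth_on (L @^-1` U) (f \o L).
Proof.
move=> oU cL fs k; elim: k f fs => [|k IH] f fs.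
  move=> x Ux; apply: continuous_comp; first exact: cL.
  exact/differentiable_continuous/(smooth_differentiable fs Ux).
split=> [x Ux|v].
  apply: differentiable_comp; first exact: linear_differentiable.
  exact: smooth_differentiable fs Ux.
apply: (@Ck_ext _ _ (L @^-1` U) _ _ _ ('D_(L v) f \o L)).
- by apply: open_comp => // x _; exact: cL.
- move=> y Uy; have df := smooth_differentiable fs Uy.
  by have [_ ->] := is_derive_precomp (differentiable_is_derive (L v) df).
- by apply: IH; exact: smooth_derive.
Qed.

Lemma lin_expand (R : realType) n (W : lmodType R) (h : 'rV[R]_n -> W) u :
  (forall a u v, h (a *: u + v) = a *: h u + h v) ->
  h u = \sum_l u 0 l *: h (delta_mx 0 l).
Proof.
move=> hl.
have h0 : h 0 = 0 by have := hl (-1) 0 0; rewrite !scaleN1r oppr0 addr0 addNr.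
by rewrite {1}[u]row_sum_delta; elim/big_rec2 : _ => // i y1 y2 _ <-; exact: hl.
Qed.

(** Expansion in the standard basis reduces a varying argument to constant ones. This covers
    ['D_(X x) Y x], which is linear in the direction. *)
Lemma smooth_lin (R : realType) (V : normedModType R) (U : set V) k m n
    (L : V -> 'rV[R]_k -> 'M[R]_(m, n)) (f : V -> 'rV[R]_k) :
  open U -> (forall x, U x -> forall a u v, L x (a *: u + v) = a *: L x u + L x v) ->
  (forall u, smooth_on U (L ^~ u)) -> smooth_on U f ->
  smooth_on U (fun x => L x (f x)).
Proof.
move=> oU Ll Ls /(smooth_mxP oU) fs.
apply: (@smooth_ext _ _ _ oU _ (fun x => \sum_l f x 0 l *: L x (delta_mx 0 l))).
  by move=> x /Ll Lx; rewrite -lin_expand.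
by apply: smooth_sum => // l _; apply: smooth_scale.
Qed.

Lemma smooth_bilin (R : realType) (V : normedModType R) (U : set V) k l m n
    (B : V -> 'rV[R]_k -> 'rV[R]_l -> 'M[R]_(m, n)) f h :
  open U -> (forall x, U x -> bilin (B x)) ->
  (forall u v, smooth_on U (fun x => B x u v)) ->
  smooth_on U f -> smooth_on U h ->
  smooth_on U (fun x => B x (f x) (h x)).
Proof.
move=> oU Bb Bs fs hs.
apply: (@smooth_lin _ _ _ _ _ _ (fun x => B x (f x))) => //.
  by move=> x /Bb[].
by move=> v; apply: (@smooth_lin _ _ _ _ _ _ (fun x u => B x u v)) => // x /Bb[].
Qed.

Lemma smooth_subset (R : realType) (V W : normedModType R) (U U' : set V)
    (f : V -> W) : U' `<=` U -> smooth_on U f -> smooth_on U' f.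
Proof.
move=> UU fs k; elim: k f fs => [|k IH] f fs; first by move=> x /UU; exact: fs 0%N x.
split=> [x /UU|v]; first exact: smooth_differentiable.
by apply: IH; exact: smooth_derive.
Qed.

Lemma smooth_local (R : realType) (V W : normedModType R) (U : set V)
    (f : V -> W) :
  (forall x, U x -> exists2 U' : set V, U' x & smooth_on U' f) -> smooth_on U f.
Proof.
move=> fs k; elim: k f fs => [|k IH] f fs.
  by move=> x /fs[U' U'x fU']; exact: fU' 0%N x U'x.
split=> [x /fs[U' U'x fU']|v]; first exact: smooth_differentiable fU' U'x.
by apply: IH => x /fs[U' U'x fU']; exists U' => //; exact: smooth_derive.
Qed.

(** * Levi-Civita connection and curvature in coordinates *)

Section InnerProducts.
Variables (R : realType) (n : nat) (B : 'M[R]_n).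
Implicit Types u v w : 'rV[R]_n.

Lemma ip_linl a u v w : ip B (a *: u + v) w = a * ip B u w + ip B v w.
Proof. by rewrite /ip !mulmxDl -!scalemxAl !mxE. Qed.

Lemma ip_linr a u v w : ip B u (a *: v + w) = a * ip B u v + ip B u w.
Proof. by rewrite /ip linearP mulmxDr -scalemxAr !mxE. Qed.

Lemma ipDl u v w : ip B (u + v) w = ip B u w + ip B v w.
Proof. by rewrite -[u in LHS]scale1r ip_linl mul1r. Qed.

Lemma ipDr u v w : ip B w (u + v) = ip B w u + ip B w v.
Proof. by rewrite -[u in LHS]scale1r ip_linr mul1r. Qed.

Lemma ip0l u : ip B 0 u = 0.
Proof. by rewrite /ip !mul0mx mxE. Qed.

Lemma ip0r u : ip B u 0 = 0.
Proof. by rewrite /ip trmx0 mulmx0 mxE. Qed.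

Lemma ipZl a u v : ip B (a *: u) v = a * ip B u v.
Proof. by rewrite -[a *: u]addr0 ip_linl ip0l addr0. Qed.

Lemma ipZr a u v : ip B u (a *: v) = a * ip B u v.
Proof. by rewrite -[a *: v]addr0 ip_linr ip0r addr0. Qed.

Lemma ipNl u v : ip B (- u) v = - ip B u v.
Proof. by rewrite -scaleN1r ipZl mulN1r. Qed.

Lemma ipNr u v : ip B u (- v) = - ip B u v.
Proof. by rewrite -scaleN1r ipZr mulN1r. Qed.

Lemma ip_delta_r u l : ip B u (delta_mx 0 l) = (u *m B) 0 l.
Proof. by rewrite /ip trmx_delta -colE mxE. Qed.

Lemma ip_suml I (r : seq I) (P : pred I) (F : I -> 'rV[R]_n) v :
  ip B (\sum_(i <- r | P i) F i) v = \sum_(i <- r | P i) ip B (F i) v.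
Proof. by rewrite /ip mulmx_suml mulmx_suml summxE. Qed.

Lemma ip_bilin : bilin (ip B : _ -> _ -> R).
Proof. by split=> [a u u' v|a u v v']; [exact: ip_linl|exact: ip_linr]. Qed.

Lemma ipC u v : B^T = B -> ip B u v = ip B v u.
Proof.
move=> Bs; rewrite /ip -[in RHS](trmxK B) Bs.
transitivity (((u *m B *m v^T)^T) 0 0); first by rewrite [RHS]mxE.
by rewrite !trmx_mul trmxK Bs mulmxA.
Qed.

Hypothesis Bpos : forall u, u != 0 -> 0 < ip B u u.

Lemma posdef_unit : B \in unitmx.
Proof.
rewrite -row_free_unit -kermx_eq0; apply/eqP/row_matrixP => i.
rewrite row0; apply/eqP/negPn/negP => /Bpos.
rewrite /ip; set r := row i _.
have /sub_kermxP -> : (r <= kermx B)%MS by exact: row_sub.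
by rewrite mul0mx mxE ltxx.
Qed.

Lemma ip_eq0 u : ip B u u = 0 -> u = 0.
Proof. by move=> u0; apply/eqP/negPn/negP => /Bpos; rewrite u0 ltxx. Qed.

Lemma ip_inj u v : (forall w, ip B u w = ip B v w) -> u = v.
Proof.
move=> H; apply/eqP; rewrite -subr_eq0; apply/eqP/ip_eq0.
by rewrite ipDl ipNl H subrr.
Qed.

(** The difference of two candidates lies in [S] and is orthogonal to [S], hence to itself. This
    settles the choice made by [xget]. *)
Lemma oproj_unique (S : set 'rV[R]_n) u s :
  (forall v w, S v -> S w -> S (v - w)) ->
  S s -> orth B S (u - s) -> oproj B S u = s.
Proof.
move=> SB Ss us; rewrite /oproj; case: xgetP => [t _ [St ut]|/(_ s)[]//].
apply/eqP; rewrite -subr_eq0; apply/eqP/ip_eq0.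
have Sts := SB _ _ St Ss.
rewrite -[X in ip B X _](subrKA u) -[t - u]opprB addrC ipDl ipNl.
by rewrite us// ut// oppr0 addr0.
Qed.

Section RowSpace.
Variables (p : nat) (F : 'M[R]_(p, n)).
Hypothesis Ff : row_free F.

(** A row [r] killed by the Gram matrix makes [r *m F] a vector of norm zero. *)
Lemma gram_unit : F *m B *m F^T \in unitmx.
Proof.
rewrite -row_free_unit -kermx_eq0; apply/eqP/row_matrixP => i.
rewrite row0; set r := row i _.
have /sub_kermxP kr : (r <= kermx (F *m B *m F^T))%MS by exact: row_sub.
apply: (row_free_inj Ff); rewrite mul0mx; apply: ip_eq0.
transitivity ((r *m (F *m B *m F^T) *m r^T) 0 0).
  by rewrite /ip trmx_mul !mulmxA.
by rewrite kr mul0mx mxE.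
Qed.

Lemma orth_gram_proj u : orth B [set v | (v <= F)%MS]
  (u - u *m B *m F^T *m invmx (F *m B *m F^T) *m F).
Proof.
move=> w /submxP[c ->]; rewrite /ip trmx_mul mulmxA.
set M := F *m B *m F^T.
rewrite (_ : (_ - _) *m B *m F^T = 0) ?mul0mx ?mxE//.
rewrite !mulmxBl; set a := u *m B *m F^T.
rewrite (_ : a *m invmx M *m F *m B *m F^T = a *m (invmx M *m M)).
  by rewrite mulVmx ?gram_unit// mulmx1 subrr.
by rewrite /M !mulmxA.
Qed.

(** The solution of the normal equations. Being a rational expression in [u], [B] and [F], it yields
    the smoothness of projections onto a distribution. *)
Lemma oproj_row_space u : oproj B [set v | (v <= F)%MS] u =
  u *m B *m F^T *m invmx (F *m B *m F^T) *m F.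
Proof.
apply: oproj_unique => /=; last exact: orth_gram_proj; last exact: submxMl.
by move=> v w vF wF; rewrite addmx_sub// eqmx_opp.
Qed.

End RowSpace.

End InnerProducts.

Lemma linear_eq (R : realType) n (W : lmodType R) (f g : 'rV[R]_n -> W) :
  (forall a u v, f (a *: u + v) = a *: f u + f v) ->
  (forall a u v, g (a *: u + v) = a *: g u + g v) ->
  (forall l, f (delta_mx 0 l) = g (delta_mx 0 l)) -> f =1 g.
Proof.
move=> fl gl fg u.
by rewrite (lin_expand _ fl) (lin_expand _ gl); apply: eq_bigr => l _; rewrite fg.
Qed.

Section DeriveCombination.
Variables (R : realType) (V : normedModType R).

Lemma derive_comb (W : normedModType R) (a : R) (f g h : V -> W) x v :
  differentiable g x -> differentiable h x ->
  (\near x, f x = a *: g x + h x) -> 'D_v f x = a *: 'D_v g x + 'D_v h x.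
Proof.
move=> dg dh E; rewrite (near_eq_derive _ E) -deriveZ; last exact: diff_derivable.
apply: deriveD; last exact: diff_derivable.
by apply: derivableZ; exact: diff_derivable.
Qed.

Lemma derive_combR (a : R) (f g h : V -> R) x v :
  differentiable g x -> differentiable h x ->
  (forall y, f y = a * g y + h y) -> 'D_v f x = a * 'D_v g x + 'D_v h x.
Proof. by move=> dg dh E; apply: derive_comb => //; exact: nearW. Qed.

Lemma derive_linR (f : V -> R) x a u v : differentiable f x ->
  'D_(a *: u + v) f x = a * 'D_u f x + 'D_v f x.
Proof. exact: is_derive_lin. Qed.

Lemma koszul_linear (a p p' q q' r r' : R) :
  2^-1 * (a * p + p' + (a * q + q') - (a * r + r')) =
  a * (2^-1 * (p + q - r)) + 2^-1 * (p' + q' - r').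
Proof. by ring. Qed.

(** The two summands are the Koszul expressions of <Gamma(u, v), w> and <Gamma(u, w), v>, with p =
    D_u <v, w>, q = D_v <u, w> and r = D_w <u, v>. *)
Lemma koszul_metric (p q r : R) :
  p = 2^-1 * (p + q - r) + 2^-1 * (p + r - q).
Proof. by field. Qed.

End DeriveCombination.

(** * Christoffel symbols of a metric on an open set *)

Record metric_on (R : realType) (n : nat) (U : set 'rV[R]_n)
    (G : 'rV[R]_n -> 'M[R]_n) : Prop := {
  metric_open : open U;
  metric_smooth : smooth_on U G;
  metric_tr : forall x, U x -> (G x)^T = G x;
  metric_pos : forall x u, U x -> u != 0 -> 0 < ip (G x) u u }.

Section LeviCivita.
Variables (R : realType) (n : nat) (G : 'rV[R]_n -> 'M[R]_n).
Implicit Types (x u v w z : 'rV[R]_n).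

(** Uniqueness of the torsion-free metric connection, at a single point: the Koszul combination of
    three instances of the metric identity isolates the pairing of [N u w] with each coordinate
    vector. It serves both for the Sasaki metric and for the change of charts. *)
Lemma christoffel_unique x (N : 'rV[R]_n -> 'rV[R]_n -> 'rV[R]_n) :
  (G x)^T = G x -> G x \in unitmx -> (forall u v, N u v = N v u) ->
  (forall u w z, 'D_u (fun y => ip (G y) w z) x =
     ip (G x) (N u w) z + ip (G x) w (N u z)) ->
  forall u w, christoffel G x u w = N u w.
Proof.
move=> Gs Gu Ns NG u w; rewrite /christoffel -[RHS](mulmxK Gu).
congr (_ *m _); apply/rowP => l; rewrite mxE -ip_delta_r !NG.
rewrite [ip _ w _]ipC// [ip _ u (N w _)]ipC// [ip _ u _]ipC//.
rewrite (Ns w u) (Ns (delta_mx 0 l) u) (Ns (delta_mx 0 l) w).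
by rewrite [ip _ (N w _) u]ipC//; field.
Qed.

Variable U : set 'rV[R]_n.
Hypothesis hG : metric_on U G.

Let oU : open U := metric_open hG.
Let Gs : smooth_on U G := metric_smooth hG.
Let Gpos x u : U x -> u != 0 -> 0 < ip (G x) u u.
Proof. exact: metric_pos. Qed.

Let G_unit x : U x -> G x \in unitmx.
Proof. by move=> Ux; apply: posdef_unit => u; exact: Gpos. Qed.

Let ipCU x u v : U x -> ip (G x) u v = ip (G x) v u.
Proof. by move=> Ux; apply: ipC; exact: (metric_tr hG). Qed.

Lemma smooth_metric u v : smooth_on U (fun x => ip (G x) u v).
Proof.
have : smooth_on U (fun x => u *m G x *m v^T).
  apply: smooth_mulmx => //; last exact: smooth_cst.
  by apply: smooth_mulmx => //; exact: smooth_cst.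
by move=> /smooth_mxP; exact.
Qed.

Let dmet u v x : U x -> differentiable (fun x => ip (G x) u v) x.
Proof. exact/smooth_differentiable/smooth_metric. Qed.

Let near_U x : U x -> \near x, U x.
Proof. by move=> Ux; apply: open_nbhs_nbhs. Qed.

Lemma derive_metric_linl x v a u u' w : U x ->
  'D_v (fun y => ip (G y) (a *: u + u') w) x =
  a * 'D_v (fun y => ip (G y) u w) x + 'D_v (fun y => ip (G y) u' w) x.
Proof.
by move=> Ux; apply: derive_combR => [||y]; [exact: dmet|exact: dmet|exact: ip_linl].
Qed.

Lemma derive_metric_linr x v a u u' w : U x ->
  'D_v (fun y => ip (G y) w (a *: u + u')) x =
  a * 'D_v (fun y => ip (G y) w u) x + 'D_v (fun y => ip (G y) w u') x.
Proof.
by move=> Ux; apply: derive_combR => [||y]; [exact: dmet|exact: dmet|exact: ip_linr].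
Qed.

Lemma derive_metric_sym x v u w : U x ->
  'D_v (fun y => ip (G y) u w) x = 'D_v (fun y => ip (G y) w u) x.
Proof.
by move=> Ux; apply: near_eq_derive; apply: filterS (near_U Ux) => y; exact: ipCU.
Qed.

(** The definition prescribes the pairings with coordinate vectors only; both sides are linear in
    [w] because the metric coefficients are differentiable. *)
Lemma koszul x u v w : U x -> ip (G x) (christoffel G x u v) w =
  2^-1 * ('D_u (fun y => ip (G y) v w) x + 'D_v (fun y => ip (G y) u w) x
          - 'D_w (fun y => ip (G y) u v) x).
Proof.
move=> Ux; move: w.
apply: (@linear_eq _ _ R (fun w => ip (G x) (christoffel G x u v) w)
  (fun w => 2^-1 * (_ + _ - _))) => [a w w'|a w w'|l].
- exact: ip_linr.
- rewrite !(derive_metric_linr _ _ _ _ _ Ux) (derive_linR _ _ _ (dmet u v Ux)).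
  exact: koszul_linear.
- by rewrite ip_delta_r /christoffel (mulmxKV (G_unit Ux)) mxE.
Qed.

Lemma christoffel_sym x u v : U x -> christoffel G x u v = christoffel G x v u.
Proof.
move=> Ux; apply: (ip_inj (fun w => Gpos Ux (u := w))) => w.
rewrite !(koszul _ _ _ Ux) (derive_metric_sym w v u Ux); congr (_ * (_ - _)).
exact: addrC.
Qed.

Lemma christoffel_metric x u v w : U x -> 'D_u (fun y => ip (G y) v w) x =
  ip (G x) (christoffel G x u v) w + ip (G x) v (christoffel G x u w).
Proof.
move=> Ux; rewrite (ipCU v _ Ux) !(koszul _ _ _ Ux).
rewrite (derive_metric_sym u w v Ux) (derive_metric_sym w u v Ux)
   (derive_metric_sym v u w Ux).
exact: koszul_metric.
Qed.

Lemma christoffel_bilin x : U x -> bilin (christoffel G x).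
Proof.
move=> Ux.
have L a u u' v : christoffel G x (a *: u + u') v =
    a *: christoffel G x u v + christoffel G x u' v.
  apply: (ip_inj (fun w => Gpos Ux (u := w))) => w.
  rewrite ip_linl !(koszul _ _ _ Ux) (derive_linR _ _ _ (dmet v w Ux)).
  rewrite !(derive_metric_linl _ _ _ _ _ Ux); exact: koszul_linear.
split=> [//|a u v v'].
by rewrite (christoffel_sym u _ Ux) L (christoffel_sym v u Ux)
  (christoffel_sym v' u Ux).
Qed.

Lemma smooth_christoffel u v : smooth_on U (fun x => christoffel G x u v).
Proof.
apply: smooth_mulmx => //; last by apply: smooth_invmx.
apply/smooth_mxP => // i j.
apply: (@smooth_ext _ _ _ oU _ (fun x => 2^-1 *
  ('D_u (fun y => ip (G y) v (delta_mx 0 j)) x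
   + 'D_v (fun y => ip (G y) u (delta_mx 0 j)) x
   + (-1) * 'D_(delta_mx 0 j) (fun y => ip (G y) u v) x))) => [y _|].
  by rewrite mxE mulN1r.
apply: smoothM => //; first exact: smooth_cst.
apply: smoothD => //; first by
  apply: smoothD => //; apply: smooth_derive; exact: smooth_metric.
apply: smoothM => //; first exact: smooth_cst.
by apply: smooth_derive; exact: smooth_metric.
Qed.

Let dchr u v x : U x -> differentiable (fun x => christoffel G x u v) x.
Proof. exact/smooth_differentiable/smooth_christoffel. Qed.

Section AlongMap.
Variables (V : normedModType R) (p : V -> 'rV[R]_n) (z d : V).
Hypotheses (dp : differentiable p z) (Uz : U (p z)).

Let near_p : \near z, U (p z).
Proof.
by apply: (differentiable_continuous dp); exact: open_nbhs_nbhs.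
Qed.

Lemma christoffel_derive (f h : V -> 'rV[R]_n) df dh :
  is_derive z d f df -> is_derive z d h dh ->
  is_derive z d (fun y => christoffel G (p y) (f y) (h y))
    ('D_('D_d p z) (fun y => christoffel G y (f z) (h z)) (p z)
     + christoffel G (p z) df (h z) + christoffel G (p z) (f z) dh).
Proof.
move=> fd hd.
have E u v := is_derive_chain d dp (dchr u v Uz).
have := @is_derive_bilin _ _ _ _ _ (fun y => christoffel G (p y)) f h z d df dh.
have -> : 'D_d (fun y => christoffel G (p y) (f z) (h z)) z =
   'D_('D_d p z) (fun y => christoffel G y (f z) (h z)) (p z).
  by have [_] := E (f z) (h z).
move=> H; refine (H _ (fun a b => @ex_derive _ _ _ _ _ _ _ (E a b)) fd hd).
by apply: filterS near_p => y; exact: christoffel_bilin.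
Qed.

(** Metric compatibility for fields along a map [p]. Below, [p] is the identity, the projection of
    TM in coordinates, or a transition map. *)
Lemma metric_derive (f h : V -> 'rV[R]_n) df dh :
  is_derive z d f df -> is_derive z d h dh ->
  is_derive z d (fun y => ip (G (p y)) (f y) (h y))
    (ip (G (p z)) (df + christoffel G (p z) ('D_d p z) (f z)) (h z)
     + ip (G (p z)) (f z) (dh + christoffel G (p z) ('D_d p z) (h z))).
Proof.
move=> fd hd.
have E u v := is_derive_chain d dp (dmet u v Uz).
have := @is_derive_bilin _ _ _ _ _ (fun y => ip (G (p y)) : _ -> _ -> R)
  f h z d df dh.
have -> : 'D_d (fun y => ip (G (p y)) (f z) (h z)) z =
   'D_('D_d p z) (fun y => ip (G y) (f z) (h z)) (p z).
  by have [_] := E (f z) (h z).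
rewrite (christoffel_metric _ _ _ Uz) ipDl ipDr => H.
have Bb : \near z, bilin (ip (G (p z)) : _ -> _ -> R).
  by apply: nearW => y; exact: ip_bilin.
have {}H := H Bb
  (fun a b => @ex_derive _ _ _ _ _ _ _ (E a b)) fd hd.
apply: (is_derive_eq H).
by rewrite -addrA addrACA; congr (_ + _); exact: addrC.
Qed.

End AlongMap.

End LeviCivita.

(** * Symmetries of the curvature tensor *)

Lemma scale_addACA (R : pzRingType) (W : lmodType R) (a : R) (x x' y y' : W) :
  (a *: x + x') + (a *: y + y') = a *: (x + y) + (x' + y').
Proof. by rewrite scalerDr addrACA. Qed.

Lemma scale_addACB (R : pzRingType) (W : lmodType R) (a : R) (x x' y y' : W) :
  a *: x + x' - (a *: y + y') = a *: (x - y) + (x' - y').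
Proof. by rewrite scalerBr opprD addrACA. Qed.

Lemma scale_oppD (R : pzRingType) (W : lmodType R) (a : R) (x y : W) :
  - (a *: x + y) = a *: (- x) + - y.
Proof. by rewrite opprD scalerN. Qed.

Lemma cyclic_sub (W : zmodType) (a b c : W) :
  (a - b) + (b - c) + (c - a) = 0.
Proof. by rewrite !subrKA subrr. Qed.

(** The hypothesis is D_u D_v <w, z> = D_v D_u <w, z> expanded by metric compatibility: the mixed
    products of first derivatives occur on both sides and cancel. *)
Lemma skew_of_swap (R : realType) n (B : 'M[R]_n) (w z a b c d e f e' f' : 'rV[R]_n) :
  (forall u v, ip B u v = ip B v u) ->
  ip B a z + ip B e f + (ip B e' f' + ip B w c) =
  ip B b z + ip B e' f' + (ip B e f + ip B w d) ->
  ip B (a - b) z = - ip B (c - d) w.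
Proof. by move=> BC; rewrite !ipDl !ipNl (BC w c) (BC w d); lra. Qed.

(** The octahedron argument: the four cyclic identities obtained by rotating (u, v, w, z) are
    combined linearly, after the skew symmetries have identified equal terms. *)
Lemma pair_symmetry (R : realType) (T : Type) (F : T -> T -> T -> T -> R) :
  (forall a b c d, F a b c d = - F b a c d) ->
  (forall a b c d, F a b c d = - F a b d c) ->
  (forall a b c d, F a b c d + F b c a d + F c a b d = 0) ->
  forall u v w z, F u v w z = F w z u v.
Proof.
move=> A S B u v w z.
have := B u v w z; have := B v w z u; have := B w z u v; have := B z u v w.
rewrite (S u v z w) (S w z v u) (S v w z u) (S z u v w) (A u w z v) (S w u z v).
rewrite (A v z u w) (S z v u w).
lra.
Qed.

Section Curvature.
Variables (R : realType) (n : nat) (G : 'rV[R]_n -> 'M[R]_n) (U : set 'rV[R]_n).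
Hypothesis hG : metric_on U G.
Implicit Types (x u v w z : 'rV[R]_n).

Let oU : open U := metric_open hG.

Let near_U x : U x -> \near x, U x.
Proof. by move=> Ux; apply: open_nbhs_nbhs. Qed.

Let ipCU x u v : U x -> ip (G x) u v = ip (G x) v u.
Proof. by move=> Ux; apply: ipC; exact: (metric_tr hG). Qed.

Let dchr u v x : U x -> differentiable (fun x => christoffel G x u v) x.
Proof. exact/smooth_differentiable/(smooth_christoffel hG). Qed.

(* Locked, like [Gam], [Rie], [Jt] and [hess] below: otherwise failing
   unification problems unfold the limits that define the derivatives. *)
Definition cov2 := locked (fun x u v w =>
  'D_u (fun y => christoffel G y v w) x
  + christoffel G x u (christoffel G x v w)).

Lemma cov2E x u v w : cov2 x u v w =
  'D_u (fun y => christoffel G y v w) x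
  + christoffel G x u (christoffel G x v w).
Proof. by rewrite /cov2 -lock. Qed.

Lemma curvE x u v w : curv G x u v w = cov2 x u v w - cov2 x v u w.
Proof.
have E v' w' : cov G (cst v') (cst w') = fun y => christoffel G y v' w'.
  by apply/funext => y; rewrite /cov derive_cst add0r.
by rewrite /curv !E !cov2E.
Qed.

Lemma curvC x u v w : curv G x u v w = - curv G x v u w.
Proof. by rewrite !curvE opprB. Qed.

Lemma cov2_sym x u v w : U x -> cov2 x u v w = cov2 x u w v.
Proof.
move=> Ux; rewrite !cov2E (christoffel_sym hG v w Ux).
rewrite (near_eq_derive (g := fun y => christoffel G y w v)) => [//|].
by apply: filterS (near_U Ux) => y; exact: christoffel_sym.
Qed.

Lemma cov2_lin1 x a u u' v w : U x ->
  cov2 x (a *: u + u') v w = a *: cov2 x u v w + cov2 x u' v w.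
Proof.
move=> Ux; rewrite !cov2E (is_derive_lin _ _ _ (dchr v w Ux)).
rewrite (christoffel_bilin hG Ux).1; exact: scale_addACA.
Qed.

Lemma cov2_lin3 x u v a w w' : U x ->
  cov2 x u v (a *: w + w') = a *: cov2 x u v w + cov2 x u v w'.
Proof.
move=> Ux; rewrite !cov2E !(christoffel_bilin hG Ux).2.
rewrite (derive_comb (a := a) (g := fun y => christoffel G y v w)
  (h := fun y => christoffel G y v w') _ (dchr v w Ux) (dchr v w' Ux)).
  exact: scale_addACA.
by apply: filterS (near_U Ux) => y Uy; rewrite (christoffel_bilin hG Uy).2.
Qed.

Lemma cov2_lin2 x u a v v' w : U x ->
  cov2 x u (a *: v + v') w = a *: cov2 x u v w + cov2 x u v' w.
Proof.
move=> Ux; rewrite (cov2_sym _ _ _ Ux) (cov2_lin3 _ _ _ _ _ Ux).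
by rewrite (cov2_sym u w v Ux) (cov2_sym u w v' Ux).
Qed.

Lemma curv_lin3 x u v a w w' : U x ->
  curv G x u v (a *: w + w') = a *: curv G x u v w + curv G x u v w'.
Proof.
move=> Ux; rewrite !curvE !(cov2_lin3 _ _ _ _ _ Ux).
exact: scale_addACB.
Qed.

Lemma curv_lin1 x a u u' v w : U x ->
  curv G x (a *: u + u') v w = a *: curv G x u v w + curv G x u' v w.
Proof.
move=> Ux; rewrite !curvE (cov2_lin1 _ _ _ _ _ Ux) (cov2_lin2 _ _ _ _ _ Ux).
exact: scale_addACB.
Qed.

Lemma curv_lin2 x u a v v' w : U x ->
  curv G x u (a *: v + v') w = a *: curv G x u v w + curv G x u v' w.
Proof.
move=> Ux; rewrite !(curvC _ u) (curv_lin1 _ _ _ _ _ Ux).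
exact: scale_oppD.
Qed.

(** Since the connection is torsion-free, [cov2] is symmetric in its last two arguments, and the six
    terms cancel in pairs. *)
Lemma bianchi x u v w : U x ->
  curv G x u v w + curv G x v w u + curv G x w u v = 0.
Proof.
move=> Ux; rewrite !curvE (cov2_sym u w v Ux) (cov2_sym v w u Ux)
  (cov2_sym w v u Ux).
exact: cyclic_sub.
Qed.

(** Metric compatibility applied twice expresses the second derivatives of <w, z>, for constant [w]
    and [z], and these commute by [derive_swap]. *)
Lemma curv_skew x u v w z : U x ->
  ip (G x) (curv G x u v w) z = - ip (G x) (curv G x u v z) w.
Proof.
move=> Ux.
have D2 a b : 'D_a ('D_b (fun y => ip (G y) w z)) x =
    ip (G x) (cov2 x a b w) z
    + ip (G x) (christoffel G x b w) (christoffel G x a z)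
    + (ip (G x) (christoffel G x a w) (christoffel G x b z)
       + ip (G x) w (cov2 x a b z)).
  transitivity ('D_a (fun y => ip (G y) (christoffel G y b w) z
       + ip (G y) w (christoffel G y b z)) x).
    apply: near_eq_derive; apply: filterS (near_U Ux) => y Uy.
    exact: (christoffel_metric hG).
  have idd : differentiable (@idfun 'rV[R]_n) x by exact: ex_diff.
  have c0 c : is_derive x a (cst c : 'rV[R]_n -> 'rV[R]_n) 0.
    exact: is_derive_cst.
  have dc c := differentiable_is_derive a (dchr b c Ux).
  have := is_deriveD (metric_derive hG idd Ux (dc w) (c0 z))
    (metric_derive hG idd Ux (c0 w) (dc z)).
  have [_ ->] : is_derive x a (@idfun 'rV[R]_n) a by exact: is_derive_id.
  by rewrite !add0r !cov2E => -[_ H]; exact: H.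
have E := derive_swap u v oU Ux (smooth_metric hG w z).
rewrite !curvE; apply: (skew_of_swap (fun a b => ipCU a b Ux)).
exact: etrans (esym (D2 u v)) (etrans E (D2 v u)).
Qed.

Lemma curv_pair x u v w z : U x ->
  ip (G x) (curv G x u v w) z = ip (G x) (curv G x w z u) v.
Proof.
move=> Ux.
apply: (@pair_symmetry _ _ (fun a b c d => ip (G x) (curv G x a b c) d)).
- by move=> a b c d; rewrite curvC ipNl.
- by move=> a b c d; exact: curv_skew.
- by move=> a b c d; rewrite -!ipDl (bianchi _ _ _ Ux) ip0l.
Qed.

Lemma curv_bilin12 x w : U x -> bilin (fun u v => curv G x u v w).
Proof.
by move=> Ux; split=> [a u u' v|a u v v']; [exact: curv_lin1|exact: curv_lin2].
Qed.

Lemma smooth_cov2 u v w : smooth_on U (fun x => cov2 x u v w).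
Proof.
apply: (@smooth_ext _ _ _ oU _ _ _ (fun y Uy => esym (cov2E y u v w))).
apply: (smoothD oU).
  by apply: smooth_derive; exact: (smooth_christoffel hG).
apply: (@smooth_bilin _ _ _ _ _ _ _ (christoffel G)) => //.
- by move=> x; exact: (christoffel_bilin hG).
- exact: (smooth_christoffel hG).
- exact: (smooth_cst oU).
- exact: (smooth_christoffel hG).
Qed.

Lemma smooth_curv u v w : smooth_on U (fun x => curv G x u v w).
Proof.
apply: (@smooth_ext _ _ _ oU _ _ _ (fun y Uy => esym (curvE y u v w))).
by apply: (smoothD oU); [|apply: (smoothN oU)]; exact: smooth_cov2.
Qed.

Lemma smooth_curv_fields (V : normedModType R) (p : {linear V -> 'rV[R]_n})
    (X Y Z : V -> 'rV[R]_n) : continuous p ->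
  smooth_on (p @^-1` U) X -> smooth_on (p @^-1` U) Y ->
  smooth_on (p @^-1` U) Z ->
  smooth_on (p @^-1` U) (fun y => curv G (p y) (X y) (Y y) (Z y)).
Proof.
move=> cp Xs Ys Zs.
have opU : open (p @^-1` U) by apply: open_comp => // x _; exact: cp.
apply: (smooth_lin (L := fun y => curv G (p y) (X y) (Y y))) => //.
  by move=> y Uy a u v; exact: curv_lin3.
move=> w.
apply: (smooth_bilin (B := fun y u v => curv G (p y) u v w)) => //.
  by move=> y Uy; exact: curv_bilin12.
by move=> u v; exact: (smooth_precomp oU cp (smooth_curv u v w)).
Qed.

End Curvature.

(** * Sasaki metric *)

Lemma bilin0l (R : realType) (W : normedModType R) m k
    (B : 'rV[R]_m -> 'rV[R]_k -> W) u : bilin B -> B 0 u = 0.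
Proof.
by move=> [Bl _]; have := Bl (-1) 0 0 u; rewrite !scaleN1r oppr0 addr0 addNr.
Qed.

Lemma bilin0r (R : realType) (W : normedModType R) m k
    (B : 'rV[R]_m -> 'rV[R]_k -> W) u : bilin B -> B u 0 = 0.
Proof.
by move=> [_ Br]; have := Br (-1) u 0 0; rewrite !scaleN1r oppr0 addr0 addNr.
Qed.

Lemma bilinDl (R : realType) (W : normedModType R) m k
    (B : 'rV[R]_m -> 'rV[R]_k -> W) u u' v : bilin B ->
  B (u + u') v = B u v + B u' v.
Proof. by move=> [Bl _]; rewrite -[u]scale1r Bl !scale1r. Qed.

Lemma bilinDr (R : realType) (W : normedModType R) m k
    (B : 'rV[R]_m -> 'rV[R]_k -> W) u v v' : bilin B ->
  B u (v + v') = B u v + B u v'.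
Proof. by move=> [_ Br]; rewrite -[v]scale1r Br !scale1r. Qed.

Lemma bilinNr (R : realType) (W : normedModType R) m k
    (B : 'rV[R]_m -> 'rV[R]_k -> W) u v : bilin B -> B u (- v) = - B u v.
Proof.
by move=> Bb; rewrite -[- v]addr0 -scaleN1r Bb.2 (bilin0r _ Bb) addr0 scaleN1r.
Qed.

Lemma bilinNl (R : realType) (W : normedModType R) m k
    (B : 'rV[R]_m -> 'rV[R]_k -> W) u v : bilin B -> B (- u) v = - B u v.
Proof.
by move=> Bb; rewrite -[- u]addr0 -scaleN1r Bb.1 (bilin0l _ Bb) addr0 scaleN1r.
Qed.

Lemma is_derive_linear (R : realType) (V W : normedModType R)
  (L : {linear V -> W}) x v : is_derive x v L (L v).
Proof. exact: (is_derive_precomp (is_derive_id (L x) (L v))). Qed.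

Definition Gam (R : realType) n (G : 'rV[R]_n -> 'M[R]_n) :=
  locked (christoffel G).
Definition Rie (R : realType) n (G : 'rV[R]_n -> 'M[R]_n) := locked (curv G).

Lemma GamE (R : realType) n (G : 'rV[R]_n -> 'M[R]_n) : christoffel G = Gam G.
Proof. by rewrite /Gam -lock. Qed.

Lemma RieE (R : realType) n (G : 'rV[R]_n -> 'M[R]_n) : curv G = Rie G.
Proof. by rewrite /Rie -lock. Qed.

Section LockedTheory.
Variables (R : realType) (n : nat) (G : 'rV[R]_n -> 'M[R]_n) (U : set 'rV[R]_n).
Hypothesis hG : metric_on U G.
Implicit Types (x u v w : 'rV[R]_n).

Lemma Gam_sym x u v : U x -> Gam G x u v = Gam G x v u.
Proof. by rewrite -GamE; exact: (christoffel_sym hG). Qed.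

Lemma Gam_bilin x : U x -> bilin (Gam G x).
Proof. by rewrite -GamE; exact: (christoffel_bilin hG). Qed.

Lemma cov2_Rie x u v w : Rie G x u v w = cov2 G x u v w - cov2 G x v u w.
Proof. by rewrite -RieE curvE. Qed.

Lemma RieC x u v w : Rie G x u v w = - Rie G x v u w.
Proof. by rewrite -RieE curvC. Qed.

Lemma Rie_bilin x w : U x -> bilin (fun u v => Rie G x u v w).
Proof. by rewrite -RieE; exact: (curv_bilin12 hG). Qed.

Lemma Rie_linr x u v a w w' : U x ->
  Rie G x u v (a *: w + w') = a *: Rie G x u v w + Rie G x u v w'.
Proof. by rewrite -RieE; exact: (curv_lin3 hG). Qed.

Lemma Rie0l x u v : U x -> Rie G x 0 u v = 0.
Proof. by move=> Ux; rewrite (bilin0l _ (Rie_bilin v Ux)). Qed.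

Lemma Rie0m x u v : U x -> Rie G x u 0 v = 0.
Proof. by move=> Ux; rewrite (bilin0r _ (Rie_bilin v Ux)). Qed.

Lemma Rie0r x u v : U x -> Rie G x u v 0 = 0.
Proof.
move=> Ux; have := Rie_linr u v (-1) 0 0 Ux.
by rewrite !scaleN1r oppr0 addr0 addNr.
Qed.

Lemma Rie_diag x u v : Rie G x u u v = 0.
Proof. by rewrite cov2_Rie subrr. Qed.

Lemma Rie_skew x u v w z : U x ->
  ip (G x) (Rie G x u v w) z = - ip (G x) (Rie G x u v z) w.
Proof. by rewrite -RieE; exact: (curv_skew hG). Qed.

Lemma Rie_pair x u v w z : U x ->
  ip (G x) (Rie G x u v w) z = ip (G x) (Rie G x w z u) v.
Proof. by rewrite -RieE; exact: (curv_pair hG). Qed.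

Section AlongMap.
Variables (V : normedModType R) (p : {linear V -> 'rV[R]_n}) (y d : V).
Hypotheses (cp : continuous p) (Uy : U (p y)).

Let dp : differentiable p y. Proof. exact: linear_differentiable. Qed.

Let Dp : 'D_d p y = p d.
Proof. by have [_ ->] := is_derive_linear p y d. Qed.

Lemma Gam_derive (f h : V -> 'rV[R]_n) df dh :
  is_derive y d f df -> is_derive y d h dh ->
  is_derive y d (fun t => Gam G (p t) (f t) (h t))
    (cov2 G (p y) (p d) (f y) (h y)
     - Gam G (p y) (p d) (Gam G (p y) (f y) (h y))
     + Gam G (p y) df (h y) + Gam G (p y) (f y) dh).
Proof.
move=> fd hd; have H := christoffel_derive hG dp Uy fd hd.
by rewrite Dp in H; rewrite cov2E -GamE addrK.
Qed.

Lemma ip_derive (f h : V -> 'rV[R]_n) df dh :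
  is_derive y d f df -> is_derive y d h dh ->
  is_derive y d (fun t => ip (G (p t)) (f t) (h t))
    (ip (G (p y)) (df + Gam G (p y) (p d) (f y)) (h y)
     + ip (G (p y)) (f y) (dh + Gam G (p y) (p d) (h y))).
Proof.
move=> fd hd; have H := metric_derive hG dp Uy fd hd.
by rewrite Dp GamE in H.
Qed.

End AlongMap.
End LockedTheory.

Section SasakiMetric.
Variables (R : realType) (n : nat) (G : 'rV[R]_n -> 'M[R]_n) (U : set 'rV[R]_n).
Hypothesis hG : metric_on U G.
Implicit Types (y z X Y Z : 'rV[R]_(n + n)) (a b c u v w : 'rV[R]_n).

Let p : {linear 'rV[R]_(n + n) -> 'rV[R]_n} := @lsubmx R 1 n n.
Let q : {linear 'rV[R]_(n + n) -> 'rV[R]_n} := @rsubmx R 1 n n.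

(** The Sasaki metric in the chart of TM induced by a chart where the metric of M is [G]. Right
    multiplication by [K] replaces the fibre component of a vector by its vertical part. *)
Definition loc_sasaki z : 'M[R]_(n + n) :=
  let K := block_mx 1%:M (\matrix_a Gam G (lsubmx z) (delta_mx 0 a) (rsubmx z))
             0 1%:M in
  K *m block_mx (G (lsubmx z)) 0 0 (G (lsubmx z)) *m K^T.

(* [vpart z X] is the vertical part of X at z in the splitting into horizontal
   and vertical subspaces (its horizontal part is [lsubmx X]); [hv z a b] is the
   vector with horizontal part a and vertical part b. *)
Definition vpart z X : 'rV[R]_n :=
  rsubmx X + Gam G (lsubmx z) (lsubmx X) (rsubmx z).

Definition hv z a b : 'rV[R]_(n + n) :=
  row_mx a (b - Gam G (lsubmx z) a (rsubmx z)).

Lemma hv_l z a b : lsubmx (hv z a b) = a.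
Proof. by rewrite row_mxKl. Qed.

Lemma hv_v z a b : vpart z (hv z a b) = b.
Proof. by rewrite /vpart /hv row_mxKl row_mxKr subrK. Qed.

Lemma mulmx_conn x u eta : U x ->
  u *m (\matrix_a Gam G x (delta_mx 0 a) eta) = Gam G x u eta.
Proof.
move=> Ux; rewrite (@lin_expand _ _ _ (fun u => Gam G x u eta) u).
  by rewrite mulmx_sum_row; apply: eq_bigr => i _; rewrite rowK.
by move=> a v v'; rewrite (Gam_bilin hG Ux).1.
Qed.

Lemma mulmx_split z X : U (lsubmx z) ->
  X *m block_mx 1%:M (\matrix_a Gam G (lsubmx z) (delta_mx 0 a) (rsubmx z))
             0 1%:M = row_mx (lsubmx X) (vpart z X).
Proof.
move=> Uz; rewrite -{1}[X]hsubmxK mul_row_block !mulmx1 mulmx0 addr0.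
by rewrite (mulmx_conn _ _ Uz) addrC.
Qed.

Lemma ip_loc_sasaki z X Y : U (lsubmx z) -> ip (loc_sasaki z) X Y =
  ip (G (lsubmx z)) (lsubmx X) (lsubmx Y)
  + ip (G (lsubmx z)) (vpart z X) (vpart z Y).
Proof.
move=> Uz; rewrite {1}/ip /loc_sasaki; set K := block_mx 1%:M _ _ _.
have -> (D : 'M[R]_(n + n)) :
    X *m (K *m D *m K^T) *m Y^T = (X *m K) *m D *m (Y *m K)^T.
  by rewrite trmx_mul !mulmxA.
rewrite !(mulmx_split _ Uz) mul_row_block !mulmx0 addr0 add0r.
by rewrite tr_row_mx mul_row_col mxE.
Qed.

Lemma loc_sasaki_tr z : U (lsubmx z) -> (loc_sasaki z)^T = loc_sasaki z.
Proof.
move=> Uz; rewrite /loc_sasaki !trmx_mul trmxK mulmxA.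
rewrite [X in _ *m X *m _](_ : _ = block_mx (G (lsubmx z)) 0 0 (G (lsubmx z)))//.
by rewrite tr_block_mx (metric_tr hG Uz) !trmx0.
Qed.

Lemma loc_sasaki_pos z X : U (lsubmx z) -> X != 0 -> 0 < ip (loc_sasaki z) X X.
Proof.
move=> Uz X0; rewrite (ip_loc_sasaki _ _ Uz).
have ge0 u : 0 <= ip (G (lsubmx z)) u u.
  have [->|u0] := eqVneq u 0; first by rewrite ip0l.
  by rewrite ltW// (metric_pos hG).
have [l0|l0] := eqVneq (lsubmx X) 0; last first.
  by rewrite ltr_wpDr// (metric_pos hG).
rewrite ltr_wpDl// (metric_pos hG)//; apply: contraNneq X0 => v0.
move: v0; rewrite /vpart l0 (bilin0l _ (Gam_bilin hG Uz)) addr0 => r0.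
by rewrite -[X]hsubmxK l0 r0 row_mx0.
Qed.

(** The connection formula specialised to fields with constant components. Subtracting half the
    curvature symmetrises [cov2] in its first two arguments. *)
Definition sasaki_gam z X Y : 'rV[R]_(n + n) :=
  hv z (Gam G (p z) (p X) (p Y)
        + 2^-1 *: (Rie G (p z) (q z) (vpart z X) (p Y)
                   + Rie G (p z) (q z) (vpart z Y) (p X)))
       (cov2 G (p z) (p X) (p Y) (q z) - 2^-1 *: Rie G (p z) (p X) (p Y) (q z)
        + Gam G (p z) (p X) (q Y) + Gam G (p z) (p Y) (q X)).

Let cp : continuous p. Proof. exact: continuous_lsubmx. Qed.

Lemma vpart_derive z d Y : U (lsubmx z) ->
  is_derive z d (vpart^~ Y)
    (cov2 G (p z) (p d) (p Y) (q z)
     - Gam G (p z) (p d) (Gam G (p z) (p Y) (q z)) + Gam G (p z) (p Y) (q d)).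
Proof.
move=> Uz.
have c0 : is_derive z d (cst (p Y)) 0 by exact: is_derive_cst.
have H := is_deriveD (is_derive_cst (q Y) z d)
  (Gam_derive hG cp Uz c0 (is_derive_linear q z d)).
by rewrite add0r (bilin0l _ (Gam_bilin hG Uz)) addr0 in H.
Qed.

Lemma near_base z : U (lsubmx z) -> \near z, U (lsubmx z).
Proof.
by move=> Uz; apply: (cp (x := z)); apply: open_nbhs_nbhs; split;
   [exact: (metric_open hG)|].
Qed.

Lemma loc_sasaki_christoffel z X Y : U (lsubmx z) ->
  christoffel loc_sasaki z X Y = sasaki_gam z X Y.
Proof.
move=> Uz; have Gb := Gam_bilin hG Uz.
apply: christoffel_unique.
- exact: loc_sasaki_tr.
- by apply: posdef_unit => u; exact: loc_sasaki_pos.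
- move=> {}X {}Y; rewrite /sasaki_gam (Gam_sym hG _ _ Uz).
  congr (hv z (_ + _ *: _) _); first exact: addrC.
  rewrite -addrA [_ + Gam _ _ (p Y) _]addrC addrA.
  rewrite -[in RHS]addrA [RHS]addrA; congr (_ + _ + _).
  rewrite !cov2_Rie; apply/rowP => i; rewrite !mxE; lra.
- move=> {}X {}Y Z.
  rewrite (near_eq_derive (g := fun y =>
      ip (G (p y)) (cst (p Y) y) (cst (p Z) y)
      + ip (G (p y)) (vpart y Y) (vpart y Z))); last first.
    by apply: filterS (near_base Uz) => y Uy; rewrite (ip_loc_sasaki _ _ Uy).
  have c0 W : is_derive z X (cst (p W)) 0 by exact: is_derive_cst.
  have [_ ->] := is_deriveD (ip_derive hG cp Uz (c0 Y) (c0 Z))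
    (ip_derive hG cp Uz (vpart_derive X Y Uz) (vpart_derive X Z Uz)).
  rewrite !(ip_loc_sasaki _ _ Uz) /sasaki_gam !hv_l !hv_v !add0r.
  (* The iterated Christoffel term produced by differentiating [vpart] cancels against the one
     contained in [vpart z W]. *)
  have E W : cov2 G (p z) (p X) (p W) (q z)
     - Gam G (p z) (p X) (Gam G (p z) (p W) (q z)) + Gam G (p z) (p W) (q X)
     + Gam G (p z) (p X) (vpart z W) =
     cov2 G (p z) (p X) (p W) (q z) + Gam G (p z) (p X) (q W)
     + Gam G (p z) (p W) (q X).
    rewrite /vpart (bilinDr _ _ _ Gb) [in LHS]addrAC; congr (_ + _).
    by rewrite [X in _ + X]addrC subrKA.
  rewrite !E /p /q /=.
  move: (vpart z X) (vpart z Y) (vpart z Z) => kX kY kZ.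
  rewrite !(ipDl, ipDr, ipNl, ipNr, ipZl, ipZr).
  have I := fun u v => ipC u v (metric_tr hG Uz).
  (* The two terms with [kX] cancel by skew symmetry. Pair symmetry cancels each of those with [kY]
     and [kZ] in the horizontal products against the curvature term of a vertical product. *)
  have := Rie_skew hG (rsubmx z) kX (lsubmx Y) (lsubmx Z) Uz.
  have := Rie_pair hG (rsubmx z) kY (lsubmx X) (lsubmx Z) Uz.
  have := Rie_pair hG (rsubmx z) kZ (lsubmx X) (lsubmx Y) Uz.
  rewrite !(I (lsubmx Y) (Rie _ _ _ _ _)) !(I kY (Rie _ _ _ _ _)).
  lra.
Qed.

End SasakiMetric.

(** * Covariant derivatives for the Sasaki metric *)

Lemma is_derive_row_mx (R : realType) (V : normedModType R) m n1 n2
    (f : V -> 'M[R]_(m, n1)) (h : V -> 'M[R]_(m, n2)) x v df dh :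
  is_derive x v f df -> is_derive x v h dh ->
  is_derive x v (fun y => row_mx (f y) (h y)) (row_mx df dh).
Proof.
move=> /is_derive_mxP fd /is_derive_mxP hd; apply/is_derive_mxP => i j.
case: (split_ordP j) => l ->.
  rewrite row_mxEl (_ : (fun y => _) = (fun y => f y i l))//.
  by apply/funext => y; rewrite row_mxEl.
rewrite row_mxEr (_ : (fun y => _) = (fun y => h y i l))//.
by apply/funext => y; rewrite row_mxEr.
Qed.

Lemma is_derive_const_along (R : realType) (V W : normedModType R)
    (f : V -> W) x v : (forall t : R, f (t *: v + x) = f x) -> is_derive x v f 0.
Proof.
move=> fc.
have E : (fun h : R => h^-1 *: ((f \o shift x) (h *: v) - f x)) = cst 0.
  by apply/funext => h /=; rewrite fc subrr scaler0.
by split; rewrite /derivable /derive E; [exact: is_cvg_cst|exact: lim_cst].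
Qed.

Lemma covE (R : realType) n (G : 'rV[R]_n -> 'M[R]_n) A B (x : 'rV[R]_n) :
  cov G A B x = 'D_(A x) B x + Gam G x (A x) (B x).
Proof. by rewrite /cov GamE. Qed.

Section SasakiConnection.
Variables (R : realType) (n : nat) (G : 'rV[R]_n -> 'M[R]_n) (U : set 'rV[R]_n).
Hypothesis hG : metric_on U G.
Implicit Types (y z : 'rV[R]_(n + n)) (a b c u v w : 'rV[R]_n).
Implicit Types (A B : 'rV[R]_(n + n) -> 'rV[R]_(n + n)).

Local Notation GS := (loc_sasaki G).
Local Notation hv := (hv G).

Let p : {linear 'rV[R]_(n + n) -> 'rV[R]_n} := @lsubmx R 1 n n.
Let q : {linear 'rV[R]_(n + n) -> 'rV[R]_n} := @rsubmx R 1 n n.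
Let cp : continuous p. Proof. exact: continuous_lsubmx. Qed.

Lemma hvD z a a' b b' : U (lsubmx z) -> hv z (a + a') (b + b') = hv z a b + hv z a' b'.
Proof.
move=> Uz; rewrite /hv (bilinDl _ _ _ (Gam_bilin hG Uz)) add_row_mx.
by rewrite opprD addrACA.
Qed.

Lemma hvB z a a' b b' : U (lsubmx z) -> hv z (a - a') (b - b') = hv z a b - hv z a' b'.
Proof.
by move=> Uz; apply/eqP; rewrite eq_sym subr_eq -hvD// !subrK.
Qed.

Lemma hv0 z : U (lsubmx z) -> hv z 0 0 = 0.
Proof. by move=> Uz; rewrite -[X in hv z X X](subrr 0) (hvB _ _ _ _ Uz) subrr. Qed.

Lemma ip_hv z a b a' b' : U (lsubmx z) -> ip (GS z) (hv z a b) (hv z a' b') =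
  ip (G (lsubmx z)) a a' + ip (G (lsubmx z)) b b'.
Proof. by move=> Uz; rewrite (ip_loc_sasaki hG _ _ Uz) !hv_l !hv_v. Qed.

(** The components [f] and [h] are functions on TM, not only on M: covariant derivatives of lifted
    fields involve the fibre coordinate and must be differentiated once more. *)
Lemma loc_sasaki_cov A B (f h : 'rV[R]_(n + n) -> 'rV[R]_n) z a c df dh :
  U (lsubmx z) -> A z = hv z a c -> (\near z, B z = hv z (f z) (h z)) ->
  is_derive z (hv z a c) f df -> is_derive z (hv z a c) h dh ->
  cov GS A B z =
  hv z (df + Gam G (lsubmx z) a (f z)
        + 2^-1 *: (Rie G (lsubmx z) (rsubmx z) c (f z)
                   + Rie G (lsubmx z) (rsubmx z) (h z) a))
       (dh + Gam G (lsubmx z) a (h z)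
        - 2^-1 *: Rie G (lsubmx z) a (f z) (rsubmx z)).
Proof.
move=> Uz Az Bz fd hd; have Gb := Gam_bilin hG Uz.
rewrite /cov (loc_sasaki_christoffel hG _ _ Uz) Az (near_eq_derive _ Bz).
rewrite (nbhs_singleton Bz).
have [_ ->] := is_derive_row_mx fd (is_deriveB hd
  (Gam_derive hG cp Uz fd (is_derive_linear q z (hv z a c)))).
rewrite /sasaki_gam /p /q /= !hv_l !hv_v.
have -> t u v : rsubmx (hv t u v) = v - Gam G (lsubmx t) u (rsubmx t).
  by rewrite row_mxKr.
set r := 2^-1 *: (Rie _ _ _ c _ + _).
rewrite /hv add_row_mx -addrA; congr row_mx; first by rewrite addrA.
rewrite row_mxKr !(bilinDl _ _ _ Gb) !(bilinDr _ _ _ Gb) !(bilinNr _ _ Gb).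
by apply/rowP => i; rewrite !mxE; lra.
Qed.

Section HorizontalDirection.
Variables (A B : 'rV[R]_(n + n) -> 'rV[R]_(n + n)) (z : 'rV[R]_(n + n)).
Variables (a : 'rV[R]_n) (Y : 'rV[R]_n -> 'rV[R]_n).
Hypotheses (Uz : U (lsubmx z)) (Az : A z = hv z a 0).
Hypothesis dY : differentiable Y (lsubmx z).

Let Yd c : is_derive z (hv z a c) (Y \o p) ('D_a Y (lsubmx z)).
Proof.
apply: is_derive_precomp; rewrite /p /= hv_l.
exact: differentiable_is_derive.
Qed.

(** Meant for a [B] that is itself a covariant derivative, with a curvature term [f] as horizontal
    part. The derivative of [f] enters only the horizontal part of the result, so its value is never
    computed. *)
Lemma vpart_cov_horizontal (f : 'rV[R]_(n + n) -> 'rV[R]_n) :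
  derivable f z (hv z a 0) ->
  (\near z, B z = hv z (f z) (Y (lsubmx z))) ->
  vpart G z (cov GS A B z) = cov G (cst a) Y (lsubmx z)
    - 2^-1 *: Rie G (lsubmx z) a (f z) (rsubmx z).
Proof.
move=> fd Bz.
rewrite (loc_sasaki_cov Uz Az Bz (derivableP fd) (Yd 0)) hv_v covE.
by [].
Qed.

(** On the zero section both curvature corrections of the horizontal part contain eta = 0, and the
    derivative of [h] enters only the vertical part. *)
Lemma lsubmx_cov_horizontal (h : 'rV[R]_(n + n) -> 'rV[R]_n) :
  derivable h z (hv z a 0) -> rsubmx z = 0 ->
  (\near z, B z = hv z (Y (lsubmx z)) (h z)) ->
  lsubmx (cov GS A B z) = cov G (cst a) Y (lsubmx z).
Proof.
move=> hd z0 Bz.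
rewrite (loc_sasaki_cov Uz Az Bz (Yd 0) (derivableP hd)) hv_l covE z0.
by rewrite !(Rie0l hG _ _ Uz) addr0 scaler0 addr0.
Qed.

Lemma cov_horizontal_vlift : (\near z, B z = hv z 0 (Y (lsubmx z))) ->
  cov GS A B z = hv z (2^-1 *: Rie G (lsubmx z) (rsubmx z) (Y (lsubmx z)) a)
    (cov G (cst a) Y (lsubmx z)).
Proof.
move=> Bz.
rewrite (loc_sasaki_cov Uz Az Bz (is_derive_cst 0 z _) (Yd 0)) covE.
rewrite !(Rie0m hG _ _ Uz) scaler0 subr0.
by rewrite (bilin0r _ (Gam_bilin hG Uz)) !add0r.
Qed.

Lemma cov_horizontal_hlift : (\near z, B z = hv z (Y (lsubmx z)) 0) ->
  cov GS A B z = hv z (cov G (cst a) Y (lsubmx z))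
    (- (2^-1 *: Rie G (lsubmx z) a (Y (lsubmx z)) (rsubmx z))).
Proof.
move=> Bz.
rewrite (loc_sasaki_cov Uz Az Bz (Yd 0) (is_derive_cst 0 z _)) covE.
rewrite !(Rie0m hG _ _ Uz) addr0 scaler0 addr0.
by rewrite (bilin0r _ (Gam_bilin hG Uz)) !add0r.
Qed.

End HorizontalDirection.

Section VerticalDirection.
Variables (A B : 'rV[R]_(n + n) -> 'rV[R]_(n + n)) (z : 'rV[R]_(n + n)).
Variables (c : 'rV[R]_n).
Hypotheses (Uz : U (lsubmx z)) (Az : A z = hv z 0 c).

Let Yd (Y : 'rV[R]_n -> 'rV[R]_n) : is_derive z (hv z 0 c) (Y \o p) 0.
Proof.
apply: is_derive_const_along => t /=; congr Y.
by rewrite linearD linearZ /= hv_l scaler0 add0r.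
Qed.

Lemma cov_vertical_hv (f : 'rV[R]_(n + n) -> 'rV[R]_n) df :
  is_derive z (hv z 0 c) f df -> (\near z, B z = hv z (f z) 0) ->
  cov GS A B z =
    hv z (df + 2^-1 *: Rie G (lsubmx z) (rsubmx z) c (f z)) 0.
Proof.
move=> fd Bz; have Gb := Gam_bilin hG Uz.
rewrite (loc_sasaki_cov Uz Az Bz fd (is_derive_cst 0 z _)).
rewrite !(Rie0l hG _ _ Uz) (Rie0m hG _ _ Uz) !(bilin0l _ Gb) scaler0.
by rewrite !addr0 subr0.
Qed.

Lemma cov_vertical_hlift (Y : 'rV[R]_n -> 'rV[R]_n) :
  (\near z, B z = hv z (Y (lsubmx z)) 0) -> cov GS A B z =
    hv z (2^-1 *: Rie G (lsubmx z) (rsubmx z) c (Y (lsubmx z))) 0.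
Proof. by move=> Bz; rewrite (cov_vertical_hv (Yd Y) Bz) add0r. Qed.

(** Geometrically, the fibres of TM are flat and totally geodesic, and vertical lifts are parallel
    along them. *)
Lemma cov_vertical_vlift (Y : 'rV[R]_n -> 'rV[R]_n) :
  (\near z, B z = hv z 0 (Y (lsubmx z))) -> cov GS A B z = 0.
Proof.
move=> Bz; have Gb := Gam_bilin hG Uz.
rewrite (loc_sasaki_cov Uz Az Bz (is_derive_cst 0 z _) (Yd Y)).
rewrite (Rie0l hG _ _ Uz) !(Rie0r hG _ _ Uz) !(bilin0l _ Gb).
by rewrite !addr0 !scaler0 !addr0 subr0 (hv0 Uz).
Qed.

End VerticalDirection.
End SasakiConnection.

(** * Tension of the lifts *)

Lemma near_all (R : realType) (V : normedModType R) (P : V -> Prop) (x : V) :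
  (forall t, P t) -> \near x, P x.
Proof. by move=> H; exact: nearW. Qed.

Lemma smooth_id (R : realType) (V : normedModType R) (U : set V) :
  open U -> smooth_on U id.
Proof.
move=> oU [|k]; first by move=> x _; exact: cvg_id.
split=> [x _|v]; first exact: ex_diff.
apply: (@Ck_ext _ _ _ oU _ _ (cst v)); last exact: Ck_cst.
by move=> y _; rewrite derive_id.
Qed.

Definition distribution_on (R : realType) n p (U : set 'rV[R]_n)
    (delta : 'rV[R]_n -> set 'rV[R]_n) : Prop :=
  forall y, U y -> exists (W : set 'rV[R]_n) (F : 'rV[R]_n -> 'M[R]_(p, n)),
    [/\ open W, W y, W `<=` U, smooth_on W F &
        forall z, W z -> row_free (F z) /\ delta z = [set u | (u <= F z)%MS]].

Section Projection.
Variables (R : realType) (n k : nat) (G : 'rV[R]_n -> 'M[R]_n).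
Variables (U : set 'rV[R]_n) (delta : 'rV[R]_n -> set 'rV[R]_n).
Hypotheses (hG : metric_on U G) (hd : distribution_on k U delta).
Implicit Types (x u v w : 'rV[R]_n).

Lemma dist_sub x u v : U x -> delta x u -> delta x v -> delta x (u - v).
Proof.
move=> /hd[W [F [_ Wx _ _ /(_ x Wx)[_ ->]]]] /= uF vF.
by rewrite addmx_sub// eqmx_opp.
Qed.

Lemma orth_projection x u : U x ->
  delta x (oproj (G x) (delta x) u) /\
  orth (G x) (delta x) (u - oproj (G x) (delta x) u).
Proof.
move=> Ux; have [W [F [_ Wx _ _ /(_ x Wx)[Ff ->]]]] := hd Ux.
rewrite (oproj_row_space (fun u => metric_pos hG Ux (u := u)) Ff); split.
  exact: submxMl.
exact: (orth_gram_proj (fun u => metric_pos hG Ux (u := u)) Ff).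
Qed.

(** Locally the projection is the Gram matrix formula for a smooth spanning family; smoothness is a
    local property. *)
Lemma smooth_oproj Y : smooth_on U Y ->
  smooth_on U (fun x => oproj (G x) (delta x) (Y x)).
Proof.
move=> Ys; apply: smooth_local => x Ux.
have [W [F [oW Wx WU Fs FP]]] := hd Ux; exists W => //.
have Gs := smooth_subset WU (metric_smooth hG).
have Fts := smooth_trmx oW Fs.
apply: (@smooth_ext _ _ _ oW _ (fun x => Y x *m G x *m (F x)^T
  *m invmx (F x *m G x *m (F x)^T) *m F x)) => [y Wy|].
  have [Ff ->] := FP y Wy; have Uy := WU y Wy.
  by rewrite (oproj_row_space (fun u => metric_pos hG Uy (u := u)) Ff).
apply: (smooth_mulmx oW _ Fs); apply: (smooth_mulmx oW).
  apply: (smooth_mulmx oW _ Fts); apply: (smooth_mulmx oW _ Gs).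
  exact: smooth_subset WU Ys.
apply: (smooth_invmx oW) => [|y Wy].
  by apply: (smooth_mulmx oW _ Fts); exact: (smooth_mulmx oW Fs Gs).
have [Ff _] := FP y Wy; have Uy := WU y Wy.
exact: (gram_unit (fun u => metric_pos hG Uy (u := u)) Ff).
Qed.

End Projection.

Lemma smooth_cov (R : realType) n (G : 'rV[R]_n -> 'M[R]_n) U E X :
  metric_on U G -> smooth_on U E -> smooth_on U X -> smooth_on U (cov G E X).
Proof.
move=> hG Es Xs; have oU := metric_open hG.
apply: (smoothD oU).
  apply: (smooth_lin (L := fun y u => 'D_u X y)) => // [x Ux a u v|u].
    exact: (is_derive_lin _ _ _ (smooth_differentiable Xs Ux)).
  exact: smooth_derive.
apply: (smooth_bilin (B := christoffel G)) => //.
  by move=> x; exact: (christoffel_bilin hG).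
exact: (smooth_christoffel hG).
Qed.

(** Here [r] carries one half from the horizontal part of the first derivative and another from the
    vertical part of the second; together they give the quarter. *)
Lemma tension_term (R : realType) n (B : 'M[R]_n) (u v w r Y : 'rV[R]_n) :
  ip B (u - 2^-1 *: (2^-1 *: r)) Y - ip B v Y - 2 * ip B w Y =
  ip B (u - v - 2 *: w) Y - 4^-1 * ip B r Y.
Proof. by rewrite !ipDl !ipNl !ipZl; field. Qed.

Section LiftedTension.
Variables (R : realType) (n k : nat) (G : 'rV[R]_n -> 'M[R]_n).
Variables (U : set 'rV[R]_n) (delta : 'rV[R]_n -> set 'rV[R]_n).
Hypotheses (hG : metric_on U G) (hd : distribution_on k U delta).
Implicit Types (y z : 'rV[R]_(n + n)) (u v w : 'rV[R]_n).

Local Notation GS := (loc_sasaki G).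
Local Notation hv := (hv G).

Let oU : open U := metric_open hG.

Definition loc_hlift z : set 'rV[R]_(n + n) :=
  [set W | delta (lsubmx z) (lsubmx W) /\ vpart G z W = 0].

Definition loc_vlift z : set 'rV[R]_(n + n) :=
  [set W | lsubmx W = 0 /\ delta (lsubmx z) (vpart G z W)].

Lemma vpartB z (X Y : 'rV[R]_(n + n)) : U (lsubmx z) ->
  vpart G z (X - Y) = vpart G z X - vpart G z Y.
Proof.
move=> Uz; rewrite /vpart !linearB /= (bilinDl _ _ _ (Gam_bilin hG Uz)).
by rewrite (bilinNl _ _ (Gam_bilin hG Uz)) opprD addrACA.
Qed.

Lemma oproj_hlift z u v : U (lsubmx z) ->
  oproj (GS z) (loc_hlift z) (hv z u v) =
  hv z (oproj (G (lsubmx z)) (delta (lsubmx z)) u) 0.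
Proof.
move=> Uz; have [du ou] := orth_projection hG hd u Uz.
apply: oproj_unique; first by move=> W W0; exact: (loc_sasaki_pos hG).
- move=> X Y [dX vX] [dY vY]; split.
    by rewrite linearB /=; exact: (dist_sub hd).
  by rewrite vpartB// vX vY subrr.
- by split; rewrite ?hv_l ?hv_v.
- move=> W [dW vW]; rewrite -(hvB hG)// (ip_loc_sasaki hG)// !hv_l !hv_v vW.
  by rewrite ip0r addr0 ou.
Qed.

Lemma oproj_vlift z u v : U (lsubmx z) ->
  oproj (GS z) (loc_vlift z) (hv z u v) =
  hv z 0 (oproj (G (lsubmx z)) (delta (lsubmx z)) v).
Proof.
move=> Uz; have [du ou] := orth_projection hG hd v Uz.
apply: oproj_unique; first by move=> W W0; exact: (loc_sasaki_pos hG).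
- move=> X Y [lX vX] [lY vY]; split; first by rewrite linearB /= lX lY subrr.
  by rewrite vpartB//; exact: (dist_sub hd).
- by split; rewrite ?hv_l ?hv_v.
- move=> W [lW vW]; rewrite -(hvB hG)// (ip_loc_sasaki hG)// !hv_l !hv_v lW.
  by rewrite ip0r add0r ou.
Qed.

Variables (E : 'I_n -> 'rV[R]_n -> 'rV[R]_n) (X : 'rV[R]_n -> 'rV[R]_n).
Hypotheses (Es : forall a, smooth_on U (E a)) (Xs : smooth_on U X).

Definition lift_frame (i : 'I_(n + n)) z : 'rV[R]_(n + n) :=
  match fintype.split i with
  | inl a => hv z (E a (lsubmx z)) 0
  | inr a => hv z 0 (E a (lsubmx z))
  end.

Lemma lift_frame_l a : lift_frame (lshift n a) = fun z => hv z (E a (lsubmx z)) 0.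
Proof.
apply/funext => z; rewrite /lift_frame (_ : fintype.split _ = inl a)//.
exact: unsplitK (inl a).
Qed.

Lemma lift_frame_r a : lift_frame (rshift n a) = fun z => hv z 0 (E a (lsubmx z)).
Proof.
apply/funext => z; rewrite /lift_frame (_ : fintype.split _ = inr a)//.
exact: unsplitK (inr a).
Qed.

Let smooth_base m (f : 'rV[R]_n -> 'M[R]_(m, n)) :
  smooth_on U f -> smooth_on (lsubmx @^-1` U) (fun z : 'rV[R]_(n + n) => f (lsubmx z)).
Proof.
exact: (@smooth_precomp _ _ _ _ _ (@lsubmx R 1 n n) f oU
  (@continuous_lsubmx _ _ _ _)).
Qed.

Let smooth_fibre : smooth_on (lsubmx @^-1` U) (@rsubmx R 1 n n).
Proof.
apply: (@smooth_subset _ _ _ setT) => //.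
exact: (@smooth_precomp _ _ _ _ _ (@rsubmx R 1 n n) id openT
  (@continuous_rsubmx _ _ _ _) (smooth_id openT)).
Qed.

Let smooth_Rie_fields (f h e : 'rV[R]_(n + n) -> 'rV[R]_n) :
  smooth_on (lsubmx @^-1` U) f -> smooth_on (lsubmx @^-1` U) h ->
  smooth_on (lsubmx @^-1` U) e ->
  smooth_on (lsubmx @^-1` U) (fun z => Rie G (lsubmx z) (f z) (h z) (e z)).
Proof.
rewrite -RieE.
exact: (smooth_curv_fields hG (p := @lsubmx R 1 n n) (@continuous_lsubmx _ _ _ _)).
Qed.

Let oTU : open (lsubmx @^-1` U : set 'rV[R]_(n + n)).
Proof. by apply: open_comp => // x _; exact: continuous_lsubmx. Qed.

Lemma smooth_hv (f h : 'rV[R]_(n + n) -> 'rV[R]_n) :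
  smooth_on (lsubmx @^-1` U) f -> smooth_on (lsubmx @^-1` U) h ->
  smooth_on (lsubmx @^-1` U) (fun z => hv z (f z) (h z)).
Proof.
move=> fs hs; apply: (smooth_row_mx oTU) => //.
apply: (smoothD oTU) => //; apply: (smoothN oTU).
apply: (smooth_bilin (B := fun z => Gam G (lsubmx z))) => //.
  by move=> z Uz; exact: (Gam_bilin hG).
by move=> u v; rewrite -GamE; exact: (smooth_base (smooth_christoffel hG u v)).
Qed.

Lemma smooth_lift_frame i : smooth_on (lsubmx @^-1` U) (lift_frame i).
Proof.
case: (split_ordP i) => a ->; rewrite ?lift_frame_l ?lift_frame_r.
  by apply: smooth_hv; [exact: smooth_base|exact: (smooth_cst oTU)].
by apply: smooth_hv; [exact: (smooth_cst oTU)|exact: smooth_base].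
Qed.

Lemma lift_frame_orthonormal z :
  U (lsubmx z) ->
  (forall a b, ip (G (lsubmx z)) (E a (lsubmx z)) (E b (lsubmx z)) = (a == b)%:R) ->
  forall i j, ip (GS z) (lift_frame i z) (lift_frame j z) = (i == j)%:R.
Proof.
move=> Uz Eo i j.
case: (split_ordP i) => a ->; case: (split_ordP j) => b ->;
  rewrite ?lift_frame_l ?lift_frame_r (ip_hv hG)// ?ip0l ?ip0r ?addr0 ?add0r.
- by rewrite Eo eq_lshift.
- by rewrite eq_lrshift.
- by rewrite eq_rlshift.
- by rewrite Eo eq_rshift.
Qed.

Definition proj_cov a x := oproj (G x) (delta x) (cov G (E a) X x).

Lemma proj_cov_diff a x : U x -> differentiable (proj_cov a) x.
Proof.
apply: smooth_differentiable; apply: (smooth_oproj hG hd).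
exact: smooth_cov.
Qed.

Let near_TU (f g : 'rV[R]_(n + n) -> 'rV[R]_(n + n)) z : U (lsubmx z) ->
  (forall y, U (lsubmx y) -> f y = g y) -> \near z, f z = g z.
Proof. by move=> Uz fg; apply: filterS fg _; exact: (near_base hG). Qed.

Let dX x : U x -> differentiable X x.
Proof. exact: smooth_differentiable. Qed.

Let dE a x : U x -> differentiable (E a) x.
Proof. exact: smooth_differentiable. Qed.

Let RieZm x c u v w : U x -> Rie G x u (c *: v) w = c *: Rie G x u v w.
Proof.
move=> Ux.
by rewrite -[c *: v]addr0 (Rie_bilin hG _ Ux).2 (Rie0m hG _ _ Ux) addr0.
Qed.

Section VerticalLift.
Variables (z : 'rV[R]_(n + n)) (Y : 'rV[R]_n).
Hypothesis Uz : U (lsubmx z).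

Let Xv z := hv z 0 (X (lsubmx z)).

Let near_Xv y : \near y, Xv y = hv y 0 (X (lsubmx y)).
Proof. by apply: near_all. Qed.

Let ip_vpart T : ip (GS z) T (hv z 0 Y) = ip (G (lsubmx z)) (vpart G z T) Y.
Proof. by rewrite (ip_loc_sasaki hG)// hv_l hv_v ip0r add0r. Qed.

Let term_v T1 T2 T3 u v w r :
  vpart G z T1 = u - 2^-1 *: (2^-1 *: r) -> vpart G z T2 = v ->
  vpart G z T3 = w ->
  ip (GS z) (T1 - T2 - 2 *: T3) (hv z 0 Y) =
  ip (G (lsubmx z)) (u - v - 2 *: w) Y - 4^-1 * ip (G (lsubmx z)) r Y.
Proof.
move=> H1 H2 H3; rewrite -tension_term -H1 -H2 -H3 -!ip_vpart.
by rewrite !ipDl !ipNl !ipZl.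
Qed.

(** The horizontal part R(eta, X) E_a / 2 of the first derivative is lost under projection onto
    sigma^v, so it contributes only to the iterated derivative, where it returns as a vertical
    curvature term. *)
Let horizontal_term a :
  let A := lift_frame (lshift n a) in
  ip (GS z) (cov GS A (cov GS A Xv) z - cov GS (cov GS A A) Xv z
    - 2 *: cov GS A (fun y => oproj (GS y) (loc_vlift y) (cov GS A Xv y)) z)
    (hv z 0 Y) =
  ip (G (lsubmx z)) (cov G (E a) (cov G (E a) X) (lsubmx z)
    - cov G (cov G (E a) (E a)) X (lsubmx z)
    - 2 *: cov G (E a) (proj_cov a) (lsubmx z)) Y
  - 4^-1 * ip (G (lsubmx z)) (Rie G (lsubmx z) (E a (lsubmx z))
      (Rie G (lsubmx z) (rsubmx z) (X (lsubmx z)) (E a (lsubmx z)))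
      (rsubmx z)) Y.
Proof.
move=> A.
have Az y : A y = hv y (E a (lsubmx y)) 0 by rewrite /A lift_frame_l.
have covX y : U (lsubmx y) -> cov GS A Xv y =
    hv y (2^-1 *: Rie G (lsubmx y) (rsubmx y) (X (lsubmx y)) (E a (lsubmx y)))
      (cov G (E a) X (lsubmx y)).
  by move=> Uy; exact: (cov_horizontal_vlift hG Uy (Az y) (dX Uy) (near_Xv y)).
apply: term_v.
- pose f y := 2^-1 *: Rie G (lsubmx y) (rsubmx y) (X (lsubmx y)) (E a (lsubmx y)).
  have fd : derivable f z (hv z (E a (lsubmx z)) 0).
    apply: diff_derivable.
    apply: (smooth_differentiable (U := lsubmx @^-1` U) _ Uz).
    apply: (smooth_scale oTU); first exact: (smooth_cst oTU).
    by apply: smooth_Rie_fields => //; exact: smooth_base.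
  have covXd := smooth_differentiable (smooth_cov hG (Es a) Xs) Uz.
  rewrite (vpart_cov_horizontal hG Uz (Az z) covXd fd (near_TU Uz covX)) /f.
  by rewrite RieZm.
(* The vertical part of this derivative is proportional to R(E_a, E_a) eta = 0. *)
- have AA : cov GS A A z = hv z (cov G (E a) (E a) (lsubmx z)) 0.
    rewrite (cov_horizontal_hlift hG Uz (Az z) (dE a Uz) (near_all z Az)).
    by rewrite Rie_diag scaler0 oppr0.
  by rewrite (cov_horizontal_vlift hG Uz AA (dX Uz) (near_Xv z)) hv_v.
- rewrite (cov_horizontal_vlift hG Uz (Az z) (proj_cov_diff a Uz)).
    exact: hv_v.
  by apply: (near_TU Uz) => y Uy; rewrite (covX y Uy) oproj_vlift.
Qed.

(** Vertical lifts are parallel along the fibres, so each of the three derivatives vanishes at every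
    eta. *)
Let vertical_term a :
  let A := lift_frame (rshift n a) in
  ip (GS z) (cov GS A (cov GS A Xv) z - cov GS (cov GS A A) Xv z
    - 2 *: cov GS A (fun y => oproj (GS y) (loc_vlift y) (cov GS A Xv y)) z)
    (hv z 0 Y) = 0.
Proof.
move=> A.
have Az y : A y = hv y 0 (E a (lsubmx y)) by rewrite /A lift_frame_r.
have covX y : U (lsubmx y) -> cov GS A Xv y = hv y 0 0.
  move=> Uy; rewrite (hv0 hG Uy).
  exact: (cov_vertical_vlift hG Uy (Az y) (near_Xv y)).
have AA : cov GS A A z = hv z 0 0.
  rewrite (hv0 hG Uz).
  exact: (cov_vertical_vlift hG Uz (Az z) (near_all z Az)).
have -> : cov GS A (cov GS A Xv) z = 0.
  exact: (cov_vertical_vlift hG Uz (Az z) (Y := cst 0) (near_TU Uz covX)).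
have -> : cov GS (cov GS A A) Xv z = 0.
  exact: (cov_vertical_vlift hG Uz AA (near_Xv z)).
have -> : cov GS A (fun y => oproj (GS y) (loc_vlift y) (cov GS A Xv y)) z = 0.
  (* The projected zero field is presented as the vertical lift of a field on M, which is the form
     required. *)
  apply: (cov_vertical_vlift hG Uz (Az z)
    (Y := fun x => oproj (G x) (delta x) 0)).
  by apply: (near_TU Uz) => y Uy; rewrite (covX y Uy) oproj_vlift.
by rewrite scaler0 !subr0 ip0l.
Qed.

Lemma tension_vlift :
  vertical_tension GS loc_vlift lift_frame Xv z (hv z 0 Y) =
  vertical_tension G delta E X (lsubmx z) Y
  - 4^-1 * \sum_a ip (G (lsubmx z)) (Rie G (lsubmx z) (E a (lsubmx z))
      (Rie G (lsubmx z) (rsubmx z) (X (lsubmx z)) (E a (lsubmx z)))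
      (rsubmx z)) Y.
Proof.
rewrite /vertical_tension !ip_suml big_split_ord /=.
rewrite [X in _ + X]big1 ?addr0; last by move=> a _; exact: vertical_term.
rewrite (eq_bigr _ (fun a _ => horizontal_term a)).
by rewrite big_split /= sumrN -mulr_sumr.
Qed.

End VerticalLift.

Section HorizontalLift.
Variables (z : 'rV[R]_(n + n)) (Y : 'rV[R]_n).
Hypotheses (Uz : U (lsubmx z)) (z0 : rsubmx z = 0).

Let Xh z := hv z (X (lsubmx z)) 0.

Let near_Xh y : \near y, Xh y = hv y (X (lsubmx y)) 0.
Proof. by apply: near_all. Qed.

Let ip_lpart T : ip (GS z) T (hv z Y 0) = ip (G (lsubmx z)) (lsubmx T) Y.
Proof. by rewrite (ip_loc_sasaki hG)// hv_l hv_v ip0r addr0. Qed.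

Let term_h T1 T2 T3 u v w :
  lsubmx T1 = u -> lsubmx T2 = v -> lsubmx T3 = w ->
  ip (GS z) (T1 - T2 - 2 *: T3) (hv z Y 0) =
  ip (G (lsubmx z)) (u - v - 2 *: w) Y.
Proof.
by move=> H1 H2 H3; rewrite !ipDl !ipNl !ipZl !ip_lpart H1 H2 H3.
Qed.

(** Pairing with a horizontal lift keeps horizontal parts only. The curvature term in the first
    derivative is vertical, and at eta = 0 the second derivative does not bring it back. *)
Let horizontal_term a :
  let A := lift_frame (lshift n a) in
  ip (GS z) (cov GS A (cov GS A Xh) z - cov GS (cov GS A A) Xh z
    - 2 *: cov GS A (fun y => oproj (GS y) (loc_hlift y) (cov GS A Xh y)) z)
    (hv z Y 0) =
  ip (G (lsubmx z)) (cov G (E a) (cov G (E a) X) (lsubmx z)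
    - cov G (cov G (E a) (E a)) X (lsubmx z)
    - 2 *: cov G (E a) (proj_cov a) (lsubmx z)) Y.
Proof.
move=> A.
have Az y : A y = hv y (E a (lsubmx y)) 0 by rewrite /A lift_frame_l.
have covX y : U (lsubmx y) -> cov GS A Xh y = hv y (cov G (E a) X (lsubmx y))
   (- (2^-1 *: Rie G (lsubmx y) (E a (lsubmx y)) (X (lsubmx y)) (rsubmx y))).
  by move=> Uy; exact: (cov_horizontal_hlift hG Uy (Az y) (dX Uy) (near_Xh y)).
apply: term_h.
- pose f y := - (2^-1 *:
    Rie G (lsubmx y) (E a (lsubmx y)) (X (lsubmx y)) (rsubmx y)).
  have fd : derivable f z (hv z (E a (lsubmx z)) 0).
    apply: diff_derivable.
    apply: (smooth_differentiable (U := lsubmx @^-1` U) _ Uz).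
    apply: (smoothN oTU); apply: (smooth_scale oTU).
      exact: (smooth_cst oTU).
    by apply: smooth_Rie_fields => //; exact: smooth_base.
  have covXd := smooth_differentiable (smooth_cov hG (Es a) Xs) Uz.
  exact: (lsubmx_cov_horizontal hG Uz (Az z) covXd fd z0 (near_TU Uz covX)).
- have AA : cov GS A A z = hv z (cov G (E a) (E a) (lsubmx z)) 0.
    rewrite (cov_horizontal_hlift hG Uz (Az z) (dE a Uz) (near_all z Az)).
    by rewrite Rie_diag scaler0 oppr0.
  by rewrite (cov_horizontal_hlift hG Uz AA (dX Uz) (near_Xh z)) hv_l.
- rewrite (cov_horizontal_hlift hG Uz (Az z) (proj_cov_diff a Uz)).
    exact: hv_l.
  by apply: (near_TU Uz) => y Uy; rewrite (covX y Uy) oproj_hlift.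
Qed.

(* In the direction E_a of the fibre, starting at the zero section, the fields
   below are constant because R(t E_a, E_a) = 0. *)
Let vertical_term a :
  let A := lift_frame (rshift n a) in
  ip (GS z) (cov GS A (cov GS A Xh) z - cov GS (cov GS A A) Xh z
    - 2 *: cov GS A (fun y => oproj (GS y) (loc_hlift y) (cov GS A Xh y)) z)
    (hv z Y 0) = 0.
Proof.
move=> A.
have Az y : A y = hv y 0 (E a (lsubmx y)) by rewrite /A lift_frame_r.
pose f y := 2^-1 *: Rie G (lsubmx y) (rsubmx y) (E a (lsubmx y)) (X (lsubmx y)).
have covX y : U (lsubmx y) -> cov GS A Xh y = hv y (f y) 0.
  by move=> Uy; exact: (cov_vertical_hlift hG Uy (Az y) (near_Xh y)).
have AA : cov GS A A z = hv z 0 0.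
  rewrite (hv0 hG Uz).
  exact: (cov_vertical_vlift hG Uz (Az z) (near_all z Az)).
pose d := hv z 0 (E a (lsubmx z)).
have ld t : lsubmx (t *: d + z) = lsubmx z.
  by rewrite linearD linearZ /= hv_l scaler0 add0r.
have rd t : rsubmx (t *: d + z) = t *: E a (lsubmx z).
  rewrite linearD linearZ /= z0 addr0; congr (_ *: _).
  by rewrite row_mxKr (bilin0l _ (Gam_bilin hG Uz)) subr0.
have fd t : f (t *: d + z) = 0.
  rewrite /f ld rd -[t *: _]addr0 (Rie_bilin hG _ Uz).1 Rie_diag.
  by rewrite (Rie0l hG _ _ Uz) scaler0 addr0 scaler0.
have fz : f z = 0 by rewrite -(fd 0) scale0r add0r.
(* The connection term R(eta, E_a) h vanishes at eta = 0, so constancy of [h] along the fibre line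
   is enough. *)
have near_cov B h : (forall t, h (t *: d + z) = h z) ->
    (\near z, B z = hv z (h z) 0) -> cov GS A B z = 0.
  move=> hc Bz.
  have H := cov_vertical_hv hG Uz (Az z) (is_derive_const_along hc) Bz.
  by rewrite H z0 (Rie0l hG _ _ Uz) scaler0 addr0 (hv0 hG Uz).
have -> : cov GS A (cov GS A Xh) z = 0.
  by apply: (near_cov _ f _ (near_TU Uz covX)) => t; rewrite fd fz.
have -> : cov GS (cov GS A A) Xh z = 0.
  rewrite (cov_vertical_hlift hG Uz AA (near_Xh z)).
  by rewrite (Rie0m hG _ _ Uz) scaler0 (hv0 hG Uz).
have -> : cov GS A (fun y => oproj (GS y) (loc_hlift y) (cov GS A Xh y)) z = 0.
  apply: (near_cov _ (fun y => oproj (G (lsubmx y)) (delta (lsubmx y)) (f y))).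
    by move=> t; rewrite ld fd fz.
  by apply: (near_TU Uz) => y Uy; rewrite (covX y Uy) oproj_hlift.
by rewrite scaler0 !subr0 ip0l.
Qed.

Lemma tension_hlift :
  vertical_tension GS loc_hlift lift_frame Xh z (hv z Y 0) =
  vertical_tension G delta E X (lsubmx z) Y.
Proof.
rewrite /vertical_tension !ip_suml big_split_ord /=.
rewrite [X in _ + X]big1 ?addr0; last by move=> a _; exact: vertical_term.
by apply: eq_bigr => a _; exact: horizontal_term.
Qed.

End HorizontalLift.
End LiftedTension.

(** * Orthonormal frames *)

Section Schur.
Variables (R : realType) (n : nat) (a : R) (b : 'rV[R]_n) (C : 'M[R]_n).
Hypothesis a0 : a != 0.

Let B : 'M[R]_(1 + n) := block_mx a%:M b b^T C.
Let S := C - a^-1 *: (b^T *m b).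

(** The Schur complement is the form induced on the orthogonal complement of the first basis vector:
    the added coordinate makes the extended vector orthogonal to it. Positivity therefore passes to
    [S]. *)
Lemma ip_schur u : ip S u u =
  ip B (row_mx (- a^-1 *: (u *m b^T)) u) (row_mx (- a^-1 *: (u *m b^T)) u).
Proof.
rewrite /ip /B mul_row_block tr_row_mx mul_row_col -scalemxAl mul_mx_scalar.
rewrite scalerA mulNr mulVf// scaleN1r addNr mul0mx add0r /S mulmxBr.
by rewrite -scalemxAl -scalemxAr mulmxA scaleNr addrC.
Qed.

(** The first row is the normalised first basis vector; the others lift an orthonormal frame of the
    Schur complement to the orthogonal complement of that vector. *)
Lemma schur_frame (r : R) (E : 'M[R]_n) : r * r * a = 1 ->
  E *m S *m E^T = 1%:M ->
  let F := block_mx r%:M 0 (- a^-1 *: (E *m b^T)) E in F *m B *m F^T = 1%:M.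
Proof.
move=> ra ES F; rewrite /F /B mulmx_block tr_block_mx mulmx_block.
rewrite !mul0mx !addr0 tr_scalar_mx trmx0 !mulmx0 !addr0 ?add0r.
rewrite -!scalemxAl !mul_mx_scalar !scalerA mulNr mulVf// scaleN1r addNr.
rewrite !mul0mx !scaler0 add0r.
rewrite (_ : - a^-1 *: _ + E *m C = E *m S); last first.
  by rewrite /S mulmxBr -scalemxAr mulmxA scaleNr addrC.
rewrite ES (_ : (r * a) *: r%:M = 1%:M); last first.
  by rewrite scale_scalar_mx mulrAC ra.
rewrite (_ : _ + _ = 0) ?scalar_mx_block//.
rewrite linearZ /= trmx_mul trmxK scale_scalar_mx !mul_scalar_mx scalerA.
rewrite -scalemxAl -scalerDl mulrN mulrAC mulfV// mul1r addNr scale0r//.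
Qed.

End Schur.

Lemma smooth_block_mx (R : realType) (V : normedModType R) (U : set V)
    m1 m2 n1 n2 (Aul : V -> 'M[R]_(m1, n1)) (Aur : V -> 'M[R]_(m1, n2))
    (Adl : V -> 'M[R]_(m2, n1)) (Adr : V -> 'M[R]_(m2, n2)) : open U ->
  smooth_on U Aul -> smooth_on U Aur -> smooth_on U Adl -> smooth_on U Adr ->
  smooth_on U (fun x => block_mx (Aul x) (Aur x) (Adl x) (Adr x)).
Proof.
move=> oU /(smooth_mxP oU) uls /(smooth_mxP oU) urs.
move=> /(smooth_mxP oU) dls /(smooth_mxP oU) drs; apply/(smooth_mxP oU) => i j.
case: (split_ordP i) => i' ->; case: (split_ordP j) => j' ->.
- by apply: (smooth_ext oU _ (uls i' j')) => x _; rewrite block_mxEul.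
- by apply: (smooth_ext oU _ (urs i' j')) => x _; rewrite block_mxEur.
- by apply: (smooth_ext oU _ (dls i' j')) => x _; rewrite block_mxEdl.
- by apply: (smooth_ext oU _ (drs i' j')) => x _; rewrite block_mxEdr.
Qed.

(** Gram-Schmidt as an induction on the dimension through Schur complements. Only positive functions
    are inverted or put under a root, so the frame is smooth on all of [U]. *)
Lemma exists_smooth_frame_mx (R : realType) (V : normedModType R) (U : set V) n
    (G : V -> 'M[R]_n) : open U -> smooth_on U G ->
  (forall x, U x -> (G x)^T = G x) ->
  (forall x u, U x -> u != 0 -> 0 < ip (G x) u u) ->
  exists2 E : V -> 'M[R]_n, smooth_on U E &
    forall x, U x -> E x *m G x *m (E x)^T = 1%:M.
Proof.
move=> oU; elim: n G => [|n IH] G Gs Gt Gp.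
  exists (cst 0); first exact: smooth_cst.
  by move=> x _; apply/matrixP => -[].
pose a x : R := G x 0 0; pose b x : 'rV[R]_n := ursubmx (G x : 'M[R]_(1 + n)).
pose C x : 'M[R]_n := drsubmx (G x : 'M[R]_(1 + n)).
have GE x : U x -> G x = block_mx (a x)%:M (b x) (b x)^T (C x).
  move=> Ux.
  have <- : ulsubmx (G x : 'M[R]_(1 + n)) = (a x)%:M.
    apply/matrixP => i j; rewrite !ord1 [RHS]mxE /= mulr1n !mxE /a.
    by congr (G x _ _); exact: val_inj.
  have <- : dlsubmx (G x : 'M[R]_(1 + n)) = (b x)^T by rewrite /b trmx_ursub Gt.
  exact: (esym (@submxK _ 1 n 1 n (G x))).
have a0 x : U x -> 0 < a x.
  move=> Ux; have /Gp : delta_mx 0 0 != 0 :> 'rV[R]_n.+1.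
    by apply/eqP => /rowP/(_ 0); rewrite !mxE => /eqP; rewrite oner_eq0.
  by move=> /(_ _ Ux); rewrite ip_delta_r -rowE mxE.
have an0 x : U x -> a x != 0 by move=> Ux; rewrite gt_eqF// a0.
move/(smooth_mxP oU) : (Gs) => Gij.
have as_ : smooth_on U a by exact: Gij.
have bs : smooth_on U b.
  apply/(smooth_mxP oU) => i j.
  by apply: (smooth_ext oU _ (Gij (lshift n i) (rshift 1 j))) => x _; rewrite !mxE.
have Cs : smooth_on U C.
  apply/(smooth_mxP oU) => i j.
  by apply: (smooth_ext oU _ (Gij (rshift 1 i) (rshift 1 j))) => x _; rewrite !mxE.
have ais : smooth_on U (fun x => (a x)^-1) by exact: (smooth_inv oU as_ an0).
pose S x := C x - (a x)^-1 *: ((b x)^T *m b x).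
have Ss : smooth_on U S.
  apply: (smoothD oU) => //; apply: (smoothN oU); apply: (smooth_scale oU) => //.
  by apply: (smooth_mulmx oU) => //; exact: (smooth_trmx oU).
have [||E Es EP] := IH S Ss.
- move=> x Ux; rewrite /S linearB linearZ /= trmx_mul trmxK; congr (_ - _).
  by rewrite /C trmx_drsub Gt.
- move=> x u Ux u0; rewrite (ip_schur _ _ (an0 x Ux)) -(GE x Ux); apply: Gp => //.
  apply: contraNneq u0 => /(congr1 (@rsubmx _ 1 1 n)).
  by rewrite row_mxKr linear0 => ->.
pose r x := (Num.sqrt (a x))^-1.
have rs : smooth_on U r by exact: smooth_rsqrt.
exists (fun x => block_mx (r x)%:M 0 (- (a x)^-1 *: (E x *m (b x)^T)) (E x)).
  have ebs : smooth_on U (fun x => - (a x)^-1 *: (E x *m (b x)^T)).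
    apply: (@smooth_ext _ _ _ oU _ (fun x => - ((a x)^-1 *: (E x *m (b x)^T)))).
      by move=> x _; rewrite scaleNr.
    apply: (smoothN oU); apply: (smooth_scale oU) => //.
    by apply: (smooth_mulmx oU) => //; exact: (smooth_trmx oU).
  have rms : smooth_on U (fun x => (r x)%:M : 'M[R]_1).
    apply: (@smooth_ext _ _ _ oU _ (fun x => r x *: 1%:M)) => [x _|].
      by rewrite scalemx1.
    by apply: (smooth_scale oU) => //; exact: (smooth_cst oU).
  exact: (smooth_block_mx oU rms (smooth_cst oU 0) ebs Es).
move=> x Ux; rewrite (GE x Ux); apply: schur_frame; [exact: an0| |exact: EP].
by rewrite -expr2 exprVn sqr_sqrtr ?mulVf ?an0// ltW// a0.
Qed.

Lemma exists_smooth_frame (R : realType) n (U : set 'rV[R]_n)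
    (G : 'rV[R]_n -> 'M[R]_n) : metric_on U G ->
  exists2 E : 'I_n -> 'rV[R]_n -> 'rV[R]_n, (forall a, smooth_on U (E a)) &
    forall x, U x -> forall a b, ip (G x) (E a x) (E b x) = (a == b)%:R.
Proof.
move=> hG; have oU := metric_open hG.
have [F Fs FP] := exists_smooth_frame_mx oU (metric_smooth hG) (metric_tr hG)
  (metric_pos hG).
exists (fun a x => row a (F x)) => [a|x Ux a b].
  apply/(smooth_mxP oU) => i j; move/(smooth_mxP oU) : Fs => Fij.
  by apply: (smooth_ext oU _ (Fij a j)) => x _; rewrite mxE.
have := congr1 (fun M : 'M[R]_n => M a b) (FP x Ux); rewrite [X in _ = X -> _]mxE => <-.
rewrite /ip -row_mul [LHS]mxE [RHS]mxE; apply: eq_bigr => j _.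
by rewrite !mxE.
Qed.

(** * Change of charts *)

Lemma mulmx_eq (R : pzRingType) m k (B C : 'M[R]_(m, k)) :
  (forall u : 'rV_m, u *m B = u *m C) -> B = C.
Proof. by move=> E; apply/row_matrixP => i; rewrite !rowE E. Qed.

Lemma ip_congr (R : realType) n (B J : 'M[R]_n) (u v : 'rV[R]_n) :
  ip (J *m B *m J^T) u v = ip B (u *m J) (v *m J).
Proof. by rewrite /ip trmx_mul !mulmxA. Qed.

Lemma derive_swap_mx (R : realType) (V : normedModType R) m k
    (f : V -> 'M[R]_(m, k)) (U : set V) (x u v : V) : open U -> U x -> smooth_on U f ->
  'D_u ('D_v f) x = 'D_v ('D_u f) x.
Proof.
move=> oU Ux fs; have fd y : U y -> differentiable f y.
  exact: smooth_differentiable.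
have fdd d y : U y -> differentiable ('D_d f) y.
  by apply: smooth_differentiable; exact: smooth_derive.
have E d e a b : 'D_d ('D_e f) x a b = 'D_d ('D_e (fun y => f y a b)) x.
  rewrite derive_mx ?mxE; last exact/diff_derivable/fdd.
  apply: near_eq_derive; apply: filterS (open_nbhs_nbhs (conj oU Ux)) => y Uy.
  by rewrite derive_mx ?mxE//; exact/diff_derivable/fd.
apply/matrixP => a b; have fab : smooth_on U (fun y => f y a b).
  by move/(smooth_mxP oU): fs; exact.
exact: etrans (E u v a b) (etrans (derive_swap u v oU Ux fab) (esym (E v u a b))).
Qed.

Section Transitions.
Variables (R : realType) (n : nat) (M : topologicalType) (A : atlas R n M).
Hypothesis hM : smooth_manifold A.
Implicit Types (i j k : idx A) (x : M) (y u v w eta : 'rV[R]_n).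

Definition overlap i j : set 'rV[R]_n := chart i @` (dom i `&` dom j).

Lemma imgP i y : img i y -> dom i (chartV i y) /\ chart i (chartV i y) = y.
Proof. by case=> x ix <-; rewrite (mfd_chartK hM ix). Qed.

Lemma overlapP i j y : overlap i j y <-> img i y /\ dom j (chartV i y).
Proof.
split=> [[x [ix jx] <-]|[/imgP[iy yE] jy]].
  by split; [exists x|rewrite (mfd_chartK hM ix)].
by exists (chartV i y).
Qed.

Lemma overlap_open i j : open (overlap i j).
Proof.
rewrite openE => y /overlapP[iy jy]; rewrite /interior.
have N1 : nbhs y (img i) by apply: open_nbhs_nbhs; split; [exact: (mfd_img_open hM)|].
have N2 : nbhs y (chartV i @^-1` dom j).
  apply: (mfd_chartV_continuous hM iy); apply: open_nbhs_nbhs.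
  by split; [exact: (mfd_dom_open hM)|].
by apply: filterS2 N1 N2 => t it jt; apply/overlapP.
Qed.

Lemma overlapW i j y : overlap i j y -> img i y.
Proof. by case/overlapP. Qed.

Lemma overlap_base i y : img i y -> overlap i (base A (chartV i y)) y.
Proof. by move=> iy; apply/overlapP; split=> //; exact: (mfd_base hM). Qed.

Lemma transP i j y : overlap i j y -> chartV j (trans i j y) = chartV i y.
Proof. by move=> /overlapP[_ jy]; rewrite /trans /= (mfd_chartK hM jy). Qed.

Lemma trans_img i j y : overlap i j y -> img j (trans i j y).
Proof. by move=> /overlapP[_ jy]; exists (chartV i y). Qed.

Lemma trans_overlap i j k y : overlap i j y -> overlap i k y ->
  overlap j k (trans i j y).
Proof.
move=> ij /overlapP[_ ky]; apply/overlapP; split; first exact: trans_img.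
by rewrite transP.
Qed.

Lemma trans_trans i j k y : overlap i j y -> trans j k (trans i j y) = trans i k y.
Proof. by move=> ij; rewrite /trans /= -/(trans i j y) transP. Qed.

Lemma trans_id i y : img i y -> trans i i y = y.
Proof. by move=> /imgP[]. Qed.

Lemma trans_smooth i j : smooth_on (overlap i j) (trans i j).
Proof. exact: (mfd_trans_smooth hM). Qed.

Lemma trans_diff i j y : overlap i j y -> differentiable (trans i j) y.
Proof. exact: smooth_differentiable (@trans_smooth i j). Qed.

Definition Jt : idx A -> idx A -> 'rV[R]_n -> 'M[R]_n :=
  locked (fun i j y => 'J (trans i j) y).

Lemma JtE i j y : 'J (trans i j) y = Jt i j y.
Proof. by rewrite /Jt -lock. Qed.

Lemma mulmx_Jt i j y u : overlap i j y -> u *m Jt i j y = 'D_u (trans i j) y.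
Proof. by move=> ij; rewrite -JtE -deriveEjacobian//; exact: trans_diff. Qed.

Lemma near_overlap i j y : overlap i j y -> \near y, overlap i j y.
Proof. by move=> ij; apply: open_nbhs_nbhs; split=> //; exact: overlap_open. Qed.

Lemma Jt_trans i j k y : overlap i j y -> overlap i k y ->
  Jt i j y *m Jt j k (trans i j y) = Jt i k y.
Proof.
move=> ij ik; apply: mulmx_eq => u; rewrite mulmxA (mulmx_Jt _ ij).
rewrite (mulmx_Jt _ (trans_overlap ij ik)) (mulmx_Jt _ ik).
have [_ <-] := is_derive_chain u (trans_diff ij) (trans_diff (trans_overlap ij ik)).
apply: near_eq_derive; apply: filterS (near_overlap ij) => t ijt.
exact: trans_trans.
Qed.

Lemma Jt_id i y : img i y -> Jt i i y = 1%:M.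
Proof.
move=> iy; have ii : overlap i i y by apply/overlapP; case/imgP: (iy).
apply: mulmx_eq => u; rewrite (mulmx_Jt _ ii) mulmx1.
transitivity ('D_u id y); last by have [] := is_derive_id y u.
apply: near_eq_derive; apply: filterS (near_overlap ii) => t /overlapW.
exact: trans_id.
Qed.

Lemma Jt_unit i j y : overlap i j y -> Jt i j y \in unitmx.
Proof.
move=> ij; have ii : overlap i i y.
  by apply/overlapP; split; [exact: overlapW ij|have /overlapW/imgP[] := ij].
by have := Jt_trans ij ii; rewrite (Jt_id (overlapW ij)) => /mulmx1_unit[].
Qed.

Lemma Jt_inj i j y u v : overlap i j y -> u *m Jt i j y = v *m Jt i j y -> u = v.
Proof. by move=> /Jt_unit Ju; apply: (can_inj (mulmxK Ju)). Qed.

Variable g : M -> 'M[R]_n.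
Hypothesis hg : riemannian A g.

Lemma to_baseE i y : to_base i y = Jt i (base A (chartV i y)) y.
Proof. exact: JtE. Qed.

(** Both sides are pulled back from the distinguished chart of the same point of M; the cocycle rule
    [Jt_trans] compares the two Jacobians. *)
Lemma loc_metric_trans i j y : overlap i j y ->
  loc_metric g i y = Jt i j y *m loc_metric g j (trans i j y) *m (Jt i j y)^T.
Proof.
move=> ij; rewrite /loc_metric !to_baseE (transP ij).
have ib := overlap_base (overlapW ij).
by rewrite -(Jt_trans ij ib) trmx_mul !mulmxA.
Qed.

Lemma ip_loc_metric i y u v : ip (loc_metric g i y) u v =
  ip (g (chartV i y)) (u *m to_base i y) (v *m to_base i y).
Proof. by rewrite /loc_metric ip_congr. Qed.

Lemma loc_metric_on i : metric_on (img i) (loc_metric g i).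
Proof.
split.
- exact: (mfd_img_open hM).
- exact: (riem_smooth hg).
- by move=> y _; rewrite /loc_metric !trmx_mul trmxK (riem_sym hg) mulmxA.
- move=> y u iy u0; rewrite ip_loc_metric; apply: (riem_pos hg).
  apply: contraNneq u0 => E; apply/eqP; apply: (Jt_inj (overlap_base iy)).
  by rewrite -to_baseE E mul0mx.
Qed.

Definition hess : idx A -> idx A -> 'rV[R]_n -> 'rV[R]_n -> 'rV[R]_n -> 'rV[R]_n :=
  locked (fun i j y u v => 'D_u ('D_v (trans i j)) y).

Lemma hessE i j y u v : 'D_u ('D_v (trans i j)) y = hess i j y u v.
Proof. by rewrite /hess -lock. Qed.

Lemma hessC i j y u v : overlap i j y -> hess i j y u v = hess i j y v u.
Proof.
move=> ij; rewrite -!hessE.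
exact: (derive_swap_mx u v (@overlap_open i j) ij (@trans_smooth i j)).
Qed.

(** Multiplied by the inverse Jacobian, the right-hand side is symmetric, since the Hessian is, and
    compatible with the metric of chart [i], since that metric is a pullback. Uniqueness of the
    Christoffel symbols concludes. *)
Lemma Gam_trans i j y u v : overlap i j y ->
  Gam (loc_metric g i) y u v *m Jt i j y = hess i j y u v
  + Gam (loc_metric g j) (trans i j y) (u *m Jt i j y) (v *m Jt i j y).
Proof.
move=> ij; have ts := @trans_smooth i j.
have hi := loc_metric_on i; have hj := loc_metric_on j.
have iy := overlapW ij; have jy := trans_img ij; have Ju := Jt_unit ij.
pose N u v := (hess i j y u v
  + Gam (loc_metric g j) (trans i j y) (u *m Jt i j y) (v *m Jt i j y))
  *m invmx (Jt i j y).
suff H : christoffel (loc_metric g i) y u v = N u v.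
  rewrite GamE in H; exact: etrans (congr1 (mulmx^~ (Jt i j y)) H) (mulmxKV Ju _).
apply: christoffel_unique.
- exact: (metric_tr hi).
- by apply: posdef_unit => t; exact: (metric_pos hi).
- by move=> a b; rewrite /N (hessC a b ij) (Gam_sym hj _ _ jy).
- move=> a b c.
  (* The metric of chart [i] is the pullback by [trans i j], so metric compatibility along that map
     applies to the fields ['D_b (trans i j)] and ['D_c (trans i j)]. *)
  transitivity ('D_a (fun t => ip (loc_metric g j (trans i j t))
      ('D_b (trans i j) t) ('D_c (trans i j) t)) y).
    apply: near_eq_derive; apply: filterS (near_overlap ij) => t ijt.
    by rewrite (loc_metric_trans ijt) ip_congr !(mulmx_Jt _ ijt).
  have dd d := differentiable_is_derive a
    (smooth_differentiable (smooth_derive d ts) ij).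
  have [_ H] := metric_derive hj (trans_diff ij) jy (dd b) (dd c).
  have Na d : N a d *m Jt i j y = 'D_a ('D_d (trans i j)) y
      + christoffel (loc_metric g j) (trans i j y)
          ('D_a (trans i j) y) ('D_d (trans i j) y).
    by rewrite /N (mulmxKV Ju) hessE GamE !(mulmx_Jt _ ij).
  have I e f : ip (loc_metric g i y) e f =
      ip (loc_metric g j (trans i j y)) (e *m Jt i j y) (f *m Jt i j y).
    by rewrite (loc_metric_trans ij) ip_congr.
  apply: etrans H _; apply: esym; apply: (f_equal2 +%R).
    exact: etrans (I _ _) (f_equal2 (ip _) (Na b) (mulmx_Jt c ij)).
  exact: etrans (I _ _) (f_equal2 (ip _) (mulmx_Jt b ij) (Na c)).
Qed.

End Transitions.

(** * Tangent bundle *)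

Lemma ip_ext (R : realType) n (B C : 'M[R]_n) :
  (forall u v, ip B u v = ip C u v) -> B = C.
Proof.
move=> E; apply/matrixP => i j.
by have := E (delta_mx 0 i) (delta_mx 0 j); rewrite !ip_delta_r -!rowE !mxE.
Qed.

Lemma ip_diag_block (R : realType) n (B : 'M[R]_n) (a b c d : 'rV[R]_n) :
  ip (block_mx B 0 0 B) (row_mx a b) (row_mx c d) = ip B a c + ip B b d.
Proof.
rewrite /ip mul_row_block !mulmx0 addr0 add0r.
by rewrite tr_row_mx mul_row_col mxE.
Qed.

(** The bilinear rule with a one-dimensional first factor, held constant at 1. *)
Lemma is_derive_lin_family (R : realType) (V W : normedModType R) k
    (L : V -> 'rV[R]_k -> W) (h : V -> 'rV[R]_k) (x v : V) dh :
  (\near x, forall a u u', L x (a *: u + u') = a *: L x u + L x u') ->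
  (forall b, derivable (L^~ b) x v) -> is_derive x v h dh ->
  is_derive x v (fun y => L y (h y)) ('D_v (L^~ (h x)) x + L x dh).
Proof.
move=> Ll Ld hd.
pose B y (u : 'rV[R]_1) w := u 0 0 *: L y w.
have Bb : \near x, bilin (B x).
  apply: filterS Ll => y Ly; split=> [a u u' w|a u w w']; rewrite /B.
    by rewrite !mxE scalerDl scalerA.
  by rewrite Ly scalerDr !scalerA mulrC.
have Bd u w : derivable (fun y => B y u w) x v by apply: derivableZ.
have one : is_derive x v (fun=> const_mx 1 : 'rV[R]_1) 0 by exact: is_derive_cst.
have := is_derive_bilin Bb Bd one hd; rewrite /B !mxE scale0r addr0 scale1r.
have E c : (fun y => 1 *: L y (c y)) = fun y => L y (c y).
  by apply/funext => y; rewrite scale1r.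
by rewrite (E h) (E (fun=> h x)).
Qed.

Section TangentBundle.
Variables (R : realType) (n : nat) (M : topologicalType) (A : atlas R n M).
Hypothesis hM : smooth_manifold A.
Implicit Types (i j : idx A) (y u v w : 'rV[R]_n) (z W : 'rV[R]_(n + n)).

Let p : {linear 'rV[R]_(n + n) -> 'rV[R]_n} := @lsubmx R 1 n n.
Let q : {linear 'rV[R]_(n + n) -> 'rV[R]_n} := @rsubmx R 1 n n.
Let cp : continuous p. Proof. exact: continuous_lsubmx. Qed.

Local Notation TA := (tangent_atlas A).

Lemma near_lsubmx (U : set 'rV[R]_n) z : open U -> U (lsubmx z) ->
  \near z, U (lsubmx z).
Proof.
by move=> oU Uz; apply: (cp (x := z)); apply: open_nbhs_nbhs.
Qed.

(** The detour through the distinguished chart cancels by the cocycle rule, leaving the map (y, eta)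
    |-> (phi(y), D_eta phi(y)) for the transition map phi. *)
Lemma tangent_trans i j z : overlap i j (lsubmx z) ->
  @trans R (n + n) _ TA i j z =
  row_mx (trans i j (lsubmx z)) ('D_(rsubmx z) (trans i j) (lsubmx z)).
Proof.
move=> ij; rewrite {1}/trans /=; congr row_mx.
have ib := overlap_base hM (overlapW hM ij).
rewrite to_baseE JtE -mulmxA (Jt_trans hM ib ij).
exact: mulmx_Jt.
Qed.

Let F i j z :=
  row_mx (trans i j (lsubmx z)) ('D_(rsubmx z) (trans i j) (lsubmx z)).

Let F_diff i j z : overlap i j (lsubmx z) -> differentiable (F i j) z.
Proof.
move=> ij; have oij := @overlap_open _ _ _ _ hM i j.
have ts := @trans_smooth _ _ _ _ hM i j.
have oT : open (p @^-1` overlap i j) by apply: open_comp => // x _; exact: cp.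
apply: (smooth_differentiable (U := p @^-1` overlap i j) _ ij).
apply: (smooth_row_mx oT); first exact: (smooth_precomp oij cp ts).
apply: (smooth_lin (L := fun z u => 'D_u (trans i j) (lsubmx z))) => //.
- move=> t ijt a u u'.
  exact: (is_derive_lin _ _ _ (smooth_differentiable ts ijt)).
- by move=> u; exact: (smooth_precomp oij cp (smooth_derive u ts)).
- apply: (@smooth_subset _ _ _ setT) => //.
  exact: (smooth_precomp (L := q) openT (@continuous_rsubmx _ _ _ _)
    (smooth_id openT)).
Qed.

Let F_derive i j z W : overlap i j (lsubmx z) -> is_derive z W (F i j)
  (row_mx (lsubmx W *m Jt i j (lsubmx z))
     (hess i j (lsubmx z) (lsubmx W) (rsubmx z)
      + rsubmx W *m Jt i j (lsubmx z))).
Proof.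
move=> ij; have ts := @trans_smooth _ _ _ _ hM i j.
have oij := @overlap_open _ _ _ _ hM i j.
rewrite !(mulmx_Jt hM _ ij) -hessE; apply: is_derive_row_mx.
  have dd : differentiable (trans i j) (p z).
    exact: (smooth_differentiable ts ij).
  exact: (is_derive_precomp (differentiable_is_derive (p W) dd)).
have D u : is_derive z W (fun t => 'D_u (trans i j) (lsubmx t))
    ('D_(lsubmx W) ('D_u (trans i j)) (lsubmx z)).
  have dd : differentiable ('D_u (trans i j)) (p z).
    exact: (smooth_differentiable (smooth_derive u ts) ij).
  exact: (is_derive_precomp (differentiable_is_derive (p W) dd)).
have H := @is_derive_lin_family _ _ _ _ (fun t u => 'D_u (trans i j) (lsubmx t))
  rsubmx z W (rsubmx W).
have Ll : \near z, forall a (u u' : 'rV[R]_n), 'D_(a *: u + u') (trans i j) (lsubmx z) =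
    a *: 'D_u (trans i j) (lsubmx z) + 'D_u' (trans i j) (lsubmx z).
  apply: filterS (near_lsubmx oij ij) => t ijt a u u'.
  exact: (is_derive_lin _ _ _ (smooth_differentiable ts ijt)).
have {}H := H Ll (fun b => @ex_derive _ _ _ _ _ _ _ (D b)) (is_derive_linear q z W).
by rewrite (@derive_val _ _ _ _ _ _ _ (D (rsubmx z))) in H.
Qed.

Lemma mulmx_tangent_jacobian i j z W : overlap i j (lsubmx z) ->
  W *m 'J (@trans R (n + n) _ TA i j) z =
  row_mx (lsubmx W *m Jt i j (lsubmx z))
    (hess i j (lsubmx z) (lsubmx W) (rsubmx z)
     + rsubmx W *m Jt i j (lsubmx z)).
Proof.
move=> ij; have oij := @overlap_open _ _ _ _ hM i j.
have E : \near z, F i j z = @trans R (n + n) _ TA i j z.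
  apply: filterS (near_lsubmx oij ij) => t ijt.
  by rewrite tangent_trans.
rewrite -deriveEjacobian; last exact: differentiable_ext E (F_diff ij).
by have [_ H] := F_derive W ij; rewrite -(near_eq_derive _ E).
Qed.

Variable g : M -> 'M[R]_n.
Hypothesis hg : riemannian A g.

Lemma mulmx_conn_mx i z u : img i (lsubmx z) ->
  let b := base A (chartV i (lsubmx z)) in
  u *m conn_mx A g (@chartV _ _ _ TA i z) =
  Gam (loc_metric g b) (trans i b (lsubmx z)) u
    (rsubmx z *m Jt i b (lsubmx z)).
Proof.
move=> iz; have ib := overlap_base hM iz.
have hG := loc_metric_on hM hg (base A (chartV i (lsubmx z))).
have H := mulmx_conn hG u
  (rsubmx z *m Jt i (base A (chartV i (lsubmx z))) (lsubmx z)) (trans_img hM ib).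
move=> b; apply: etrans H; congr (_ *m _); rewrite /conn_mx GamE /=.
by rewrite to_baseE.
Qed.

Lemma mulmx_to_base i z W : img i (lsubmx z) ->
  let b := base A (chartV i (lsubmx z)) in
  W *m @to_base _ _ _ TA i z =
  row_mx (lsubmx W *m Jt i b (lsubmx z))
    (hess i b (lsubmx z) (lsubmx W) (rsubmx z)
     + rsubmx W *m Jt i b (lsubmx z)).
Proof.
by move=> iz b; apply: mulmx_tangent_jacobian; exact: overlap_base.
Qed.

(** The Hessian in the Jacobian of the TM chart is the one in the transformation law of the
    Christoffel symbols. Hence vertical parts change by the Jacobian of the base, like tangent
    vectors of M. *)
Lemma vpart_Jt i j z W : overlap i j (lsubmx z) ->
  hess i j (lsubmx z) (lsubmx W) (rsubmx z) + rsubmx W *m Jt i j (lsubmx z)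
  + Gam (loc_metric g j) (trans i j (lsubmx z)) (lsubmx W *m Jt i j (lsubmx z))
      (rsubmx z *m Jt i j (lsubmx z)) =
  vpart (loc_metric g i) z W *m Jt i j (lsubmx z).
Proof.
move=> ij; rewrite /vpart mulmxDl (Gam_trans hM hg _ _ ij).
by rewrite addrAC addrC.
Qed.

(** Splitting a vector in the distinguished chart gives the images under [to_base] of its two parts
    in chart [i], so the two forms agree on every pair of vectors. *)
Lemma loc_sasakiE i z : img i (lsubmx z) ->
  @loc_metric _ _ _ TA (sasaki A g) i z = loc_sasaki (loc_metric g i) z.
Proof.
move=> iz; have ib := overlap_base hM iz; have hG := loc_metric_on hM hg i.
apply: ip_ext => W Z; rewrite (ip_loc_sasaki hG _ _ iz) !(ip_loc_metric g i).
have E X : X *m @to_base _ _ _ TA i z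
    *m block_mx 1%:M (conn_mx A g (@chartV _ _ _ TA i z)) 0 1%:M =
    row_mx (lsubmx X *m to_base i (lsubmx z))
      (vpart (loc_metric g i) z X *m to_base i (lsubmx z)).
  rewrite (mulmx_to_base _ iz) mul_row_block !mulmx1 mulmx0 addr0.
  by rewrite (mulmx_conn_mx _ iz) /= addrC (vpart_Jt _ ib) to_baseE.
rewrite [X in ip X W Z]/loc_metric ip_congr /sasaki ip_congr !E.
exact: ip_diag_block.
Qed.

Variable sigma : M -> set 'rV[R]_n.

Lemma loc_hliftE i z : img i (lsubmx z) ->
  @loc_dist _ _ _ TA (hlift_dist A g sigma) i z =
  loc_hlift (loc_metric g i) (loc_dist sigma i) z.
Proof.
move=> iz; have ib := overlap_base hM iz; have hG := loc_metric_on hM hg i.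
apply/seteqP; split=> W; rewrite /loc_dist /loc_hlift /= /hlift_dist /= /hlift.
  case=> s ss; rewrite (mulmx_to_base _ iz) (mulmx_conn_mx _ iz) /=.
  move=> /eq_row_mx[sE E]; rewrite to_baseE -sE; split=> //.
  apply: (Jt_inj hM ib); rewrite -(vpart_Jt _ ib) -E -sE addNr mul0mx//.
case=> ss v0; rewrite to_baseE in ss.
exists (lsubmx W *m Jt i (base A (chartV i (lsubmx z))) (lsubmx z)) => //.
rewrite (mulmx_to_base _ iz) (mulmx_conn_mx _ iz) /=; congr row_mx.
by apply/eqP; rewrite eq_sym -addr_eq0 (vpart_Jt _ ib) v0 mul0mx.
Qed.

Lemma loc_vliftE i z : img i (lsubmx z) ->
  @loc_dist _ _ _ TA (vlift_dist sigma) i z =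
  loc_vlift (loc_metric g i) (loc_dist sigma i) z.
Proof.
move=> iz; have ib := overlap_base hM iz; have hG := loc_metric_on hM hg i.
have hGb := loc_metric_on hM hg (base A (chartV i (lsubmx z))).
have E W : lsubmx W = 0 ->
    hess i (base A (chartV i (lsubmx z))) (lsubmx z) (lsubmx W) (rsubmx z)
      + rsubmx W *m Jt i (base A (chartV i (lsubmx z))) (lsubmx z) =
    vpart (loc_metric g i) z W *m to_base i (lsubmx z).
  move=> l0; rewrite to_baseE -(vpart_Jt _ ib) l0 mul0mx.
  by rewrite (bilin0l _ (Gam_bilin hGb (trans_img hM ib))) addr0.
apply/seteqP; split=> W; rewrite /loc_dist /loc_vlift /= /vlift_dist /= /vlift.
  case=> s ss; rewrite (mulmx_to_base _ iz) => /eq_row_mx[/esym l0 sE].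
  have {}l0 : lsubmx W = 0 by apply: (Jt_inj hM ib); rewrite l0 mul0mx.
  by split=> //; rewrite -(E _ l0) -sE.
case=> l0; rewrite -(E _ l0) => ss.
by eexists; first exact: ss; rewrite (mulmx_to_base _ iz) l0 mul0mx.
Qed.

Lemma tangent_img i z : img i (lsubmx z) -> @img _ _ _ TA i z.
Proof.
move=> iz; have [ix yE] := imgP hM iz.
have ii : overlap i i (lsubmx z) by apply/overlapP.
exists (@chartV _ _ _ TA i z); first exact: ix.
transitivity (@trans _ _ _ TA i i z) => //.
rewrite (tangent_trans ii) -(mulmx_Jt hM _ ii) (Jt_id hM iz) mulmx1.
by rewrite trans_id// hsubmxK.
Qed.

End TangentBundle.

(** * Harmonic lifts *)

Section Locality.
Variables (R : realType) (n : nat) (G G' : 'rV[R]_n -> 'M[R]_n).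
Variables (U : set 'rV[R]_n).
Hypotheses (oU : open U) (GG' : forall y, U y -> G y = G' y).

Lemma cov_ext (E E' B B' : 'rV[R]_n -> 'rV[R]_n) x : U x ->
  E x = E' x -> (forall y, U y -> B y = B' y) ->
  cov G E B x = cov G' E' B' x.
Proof.
move=> Ux EE' BB'; rewrite /cov EE' (BB' x Ux); apply: (f_equal2 +%R).
  by apply: near_eq_derive; exact: (open_near_eq oU).
rewrite /christoffel (GG' Ux); congr (_ *m _); apply/rowP => l; rewrite !mxE.
have D d u v : 'D_d (fun y => ip (G y) u v) x = 'D_d (fun y => ip (G' y) u v) x.
  by apply: near_eq_derive; apply: (open_near_eq oU) Ux => y Uy; rewrite GG'.
by congr (_ * (_ + _ - _)); exact: D.
Qed.

(** The chart expressions of the Sasaki metric and of the lifts are known over the image of the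
    chart only; the tension at a point depends only on their germs there. *)
Lemma vertical_tension_ext (delta delta' : 'rV[R]_n -> set 'rV[R]_n) E X x Y :
  (forall y, U y -> delta y = delta' y) -> U x ->
  vertical_tension G delta E X x Y = vertical_tension G' delta' E X x Y.
Proof.
move=> dd Ux.
have C A B y : U y -> cov G A B y = cov G' A B y by move=> Uy; exact: cov_ext.
have E1 a : cov G (E a) (cov G (E a) X) x = cov G' (E a) (cov G' (E a) X) x.
  exact: (cov_ext Ux erefl (fun y => @C _ _ y)).
have E2 a : cov G (cov G (E a) (E a)) X x = cov G' (cov G' (E a) (E a)) X x.
  exact: (cov_ext Ux (C _ _ _ Ux) (fun y _ => erefl)).
have E3 a : cov G (E a) (fun y => oproj (G y) (delta y) (cov G (E a) X y)) x =
    cov G' (E a) (fun y => oproj (G' y) (delta' y) (cov G' (E a) X y)) x.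
  apply: (cov_ext Ux erefl) => y Uy.
  exact: etrans (f_equal2 (fun B S => oproj B S _) (GG' Uy) (dd y Uy))
    (congr1 (oproj (G' y) (delta' y)) (C _ _ y Uy)).
rewrite /vertical_tension (GG' Ux).
apply: (congr1 (fun s => ip (G' x) s Y)); apply: eq_bigr => a _.
exact: (f_equal2 (fun u v => u - 2 *: v)
  (f_equal2 (fun u v => u - v) (E1 a) (E2 a)) (E3 a)).
Qed.

End Locality.

Section Harmonic.
Variables (R : realType) (n k : nat) (M : topologicalType) (A : atlas R n M).
Variables (g : M -> 'M[R]_n) (sigma : M -> set 'rV[R]_n).
Hypotheses (hM : smooth_manifold A) (hg : riemannian A g).
Hypothesis hs : smooth_distribution A k sigma.

Local Notation TA := (tangent_atlas A).

Lemma loc_metric_sub i V : open V -> V `<=` img i ->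
  metric_on V (loc_metric (A := A) g i).
Proof.
move=> oV Vi; have hG := loc_metric_on hM hg i; split=> //.
- exact: smooth_subset Vi (metric_smooth hG).
- by move=> x /Vi; exact: (metric_tr hG).
- by move=> x u /Vi; exact: (metric_pos hG).
Qed.

Lemma loc_dist_on i V : open V -> V `<=` img i ->
  distribution_on k V (loc_dist (A := A) sigma i).
Proof.
move=> oV Vi y Vy; have [W [F [oW Wy Wi Fs FP]]] := hs (Vi y Vy).
exists (W `&` V), F; split=> //; first exact: openI.
- exact: smooth_subset Fs.
- by move=> z [Wz _]; exact: FP.
Qed.

Section LocalData.
Variables (i : idx A) (V : set 'rV[R]_n).
Variables (E : 'I_n -> 'rV[R]_n -> 'rV[R]_n) (X : 'rV[R]_n -> 'rV[R]_n).
Hypotheses (oV : open V) (Vi : V `<=` img i) (Es : forall a, smooth_on V (E a)).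
Hypothesis Eo : forall z, V z ->
  forall a b, ip (loc_metric g i z) (E a z) (E b z) = (a == b)%:R.
Hypotheses (Xs : smooth_on V X) (Xd : forall z, V z -> loc_dist sigma i z (X z)).

Let G := loc_metric g i.
Let delta := loc_dist sigma i.
Let hG : metric_on V G := loc_metric_sub oV Vi.
Let hd : distribution_on k V delta := loc_dist_on oV Vi.

Let TV : set 'rV[R]_(n + n) := lsubmx @^-1` V.

Let oTV : open TV.
Proof. by apply: open_comp => // x _; exact: continuous_lsubmx. Qed.

Let TVi : TV `<=` @img _ _ _ TA i.
Proof. by move=> z Vz; apply: (tangent_img hM); exact: Vi. Qed.

Let Gsas z : TV z -> @loc_metric _ _ _ TA (sasaki A g) i z = loc_sasaki G z.
Proof. by move=> Vz; apply: (loc_sasakiE hM hg); exact: Vi. Qed.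

Let frame_orthonormal z : TV z -> forall a b,
  ip (@loc_metric _ _ _ TA (sasaki A g) i z)
    (lift_frame G E a z) (lift_frame G E b z) = (a == b)%:R.
Proof.
move=> Vz a b; rewrite (Gsas Vz).
exact: (lift_frame_orthonormal hG Vz (Eo Vz)).
Qed.

Let smooth_base (f : 'rV[R]_n -> 'rV[R]_n) :
  smooth_on V f -> smooth_on TV (fun z : 'rV[R]_(n + n) => f (lsubmx z)).
Proof.
exact: (@smooth_precomp _ _ _ _ _ (@lsubmx R 1 n n) f oV
  (@continuous_lsubmx _ _ _ _)).
Qed.

Lemma tension_of_harmonic_hlift y Y :
  harmonic_distribution TA (sasaki A g) (hlift_dist A g sigma) ->
  V y -> orth (G y) (delta y) Y -> vertical_tension G delta E X y Y = 0.
Proof.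
(* The zero vector over [y], where the curvature corrections disappear. *)
move=> H Vy Yo; pose z : 'rV[R]_(n + n) := row_mx y 0.
have zl : lsubmx z = y by rewrite row_mxKl.
have Vz : V (lsubmx z) by rewrite zl.
have D t : TV t -> @loc_dist _ _ _ TA (hlift_dist A g sigma) i t =
    loc_hlift G delta t.
  by move=> Vt; apply: (loc_hliftE hM hg); exact: Vi.
(* Harmonicity on TM is used for the lifted frame and the lifted section alone, over the whole
   preimage of [V]. *)
have := H i TV (lift_frame G E) (fun t => hv G t (X (lsubmx t)) 0) oTV TVi
  (smooth_lift_frame hG Es) frame_orthonormal
  (smooth_hv hG (smooth_base Xs) (smooth_cst oTV 0)) _ z Vz (hv G z Y 0) _.
rewrite (vertical_tension_ext oTV Gsas _ _ _ D Vz).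
rewrite (tension_hlift hG hd Es Xs Y Vz (row_mxKr _ _)) zl; apply.
- by move=> t Vt; rewrite (D t Vt); split; rewrite ?hv_l ?hv_v//; exact: Xd.
- move=> W; rewrite (D z Vz) => -[dW vW].
  rewrite (Gsas Vz) (ip_loc_sasaki hG _ _ Vz) hv_l hv_v vW ip0r addr0 zl.
  by apply: Yo; rewrite -zl.
Qed.

Lemma tension_of_harmonic_vlift y eta Y :
  harmonic_distribution TA (sasaki A g) (vlift_dist sigma) ->
  V y -> orth (G y) (delta y) Y ->
  vertical_tension G delta E X y Y
  - 4^-1 * \sum_a ip (G y) (Rie G y (E a y) (Rie G y eta (X y) (E a y)) eta) Y = 0.
Proof.
move=> H Vy Yo; pose z : 'rV[R]_(n + n) := row_mx y eta.
have zl : lsubmx z = y by rewrite row_mxKl.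
have Vz : V (lsubmx z) by rewrite zl.
have D t : TV t -> @loc_dist _ _ _ TA (vlift_dist sigma) i t =
    loc_vlift G delta t.
  by move=> Vt; apply: (loc_vliftE hM hg); exact: Vi.
have := H i TV (lift_frame G E) (fun t => hv G t 0 (X (lsubmx t))) oTV TVi
  (smooth_lift_frame hG Es) frame_orthonormal
  (smooth_hv hG (smooth_cst oTV 0) (smooth_base Xs)) _ z Vz (hv G z 0 Y) _.
rewrite (vertical_tension_ext oTV Gsas _ _ _ D Vz).
rewrite (tension_vlift hG hd Es Xs Y Vz) zl row_mxKr; apply.
- by move=> t Vt; rewrite (D t Vt); split; rewrite ?hv_l ?hv_v//; exact: Xd.
- move=> W; rewrite (D z Vz) => -[lW vW].
  rewrite (Gsas Vz) (ip_loc_sasaki hG _ _ Vz) hv_l hv_v lW ip0r add0r zl.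
  by apply: Yo; rewrite -zl.
Qed.

Lemma vlift_tension_eq0 y Y :
  harmonic_distribution TA (sasaki A g) (vlift_dist sigma) ->
  V y -> orth (G y) (delta y) Y -> vertical_tension G delta E X y Y = 0.
Proof.
move=> H Vy Yo; have := tension_of_harmonic_vlift 0 H Vy Yo.
rewrite big1 ?mulr0 ?subr0// => a _.
by rewrite (Rie0r hG _ _ Vy) ip0l.
Qed.

(* Polarizing at eta = X + Y turns the curvature term into the sum of the
   |R(X, Y) E_a|^2. *)
Lemma vlift_curv_frame_eq0 y Y a :
  harmonic_distribution TA (sasaki A g) (vlift_dist sigma) ->
  V y -> orth (G y) (delta y) Y -> Rie G y (X y) Y (E a y) = 0.
Proof.
move=> H Vy Yo; have := tension_of_harmonic_vlift (X y + Y) H Vy Yo.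
rewrite (vlift_tension_eq0 H Vy Yo) sub0r => /eqP.
rewrite oppr_eq0 mulf_eq0 invr_eq0 pnatr_eq0 /= => /eqP S0.
(* Pair symmetry turns the summand into <R(eta, Y) E_b, R(eta, X) E_b>; at eta = X + Y the two
   factors are R(X, Y) E_b and its opposite. *)
have T b : ip (G y) (Rie G y (E b y) (Rie G y (X y + Y) (X y) (E b y)) (X y + Y)) Y
    = - ip (G y) (Rie G y (X y) Y (E b y)) (Rie G y (X y) Y (E b y)).
  have Rb := Rie_bilin hG (E b y) Vy.
  rewrite (Rie_pair hG _ _ _ _ Vy) !(bilinDl _ _ _ Rb) !Rie_diag addr0 add0r.
  by rewrite (RieC _ _ Y) ipNr.
have pos b : 0 <= ip (G y) (Rie G y (X y) Y (E b y)) (Rie G y (X y) Y (E b y)).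
  have [->|u0] := eqVneq (Rie G y (X y) Y (E b y)) 0; first by rewrite ip0l.
  by rewrite ltW// (metric_pos hG).
apply: (ip_eq0 (fun u => metric_pos hG Vy (u := u))).
move: S0; rewrite (eq_bigr _ (fun b _ => T b)) sumrN => /eqP; rewrite oppr_eq0.
by rewrite psumr_eq0// => /allP/(_ a (mem_index_enum a))/eqP.
Qed.

End LocalData.

Lemma harmonic_of_hlift :
  harmonic_distribution TA (sasaki A g) (hlift_dist A g sigma) ->
  harmonic_distribution A g sigma.
Proof.
move=> H i V E X oV Vi Es Eo Xs Xd y Vy Y Yo.
exact: (tension_of_harmonic_hlift oV Vi Es Eo Xs Xd H Vy Yo).
Qed.

Lemma harmonic_of_vlift :
  harmonic_distribution TA (sasaki A g) (vlift_dist sigma) ->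
  harmonic_distribution A g sigma.
Proof.
move=> H i V E X oV Vi Es Eo Xs Xd y Vy Y Yo.
exact: (vlift_tension_eq0 oV Vi Es Eo Xs Xd H Vy Yo).
Qed.

Let y0 x := chart (base A x) x.

Lemma base_img x : img (base A x) (y0 x).
Proof. by exists x => //; exact: (mfd_base hM). Qed.

Lemma chartV_base x : chartV (base A x) (y0 x) = x.
Proof. by rewrite /y0 (mfd_chartK hM)//; exact: (mfd_base hM). Qed.

Lemma to_base1 x : to_base (base A x) (y0 x) = 1%:M.
Proof. by rewrite to_baseE chartV_base (Jt_id hM)//; exact: base_img. Qed.

Lemma loc_metric_base x : loc_metric g (base A x) (y0 x) = g x.
Proof. by rewrite /loc_metric to_base1 chartV_base trmx1 mul1mx mulmx1. Qed.

Lemma loc_dist_base x : loc_dist sigma (base A x) (y0 x) = sigma x.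
Proof.
by apply/seteqP; split=> u; rewrite /loc_dist /= to_base1 chartV_base mulmx1.
Qed.

(** Harmonicity is about local fields, so [u] is extended by constant coefficients in a local
    spanning family, and an orthonormal frame is constructed around [x]. The chart is [base A x], in
    which components at [x] are the given ones. *)
Lemma vlift_curvature x u v w :
  harmonic_distribution TA (sasaki A g) (vlift_dist sigma) ->
  sigma x u -> orth (g x) (sigma x) v -> curvature A g x u v w = 0.
Proof.
move=> H su ov; pose b := base A x; pose G := loc_metric g b.
have by0 := base_img x.
have [V [F [oV Vy Vi Fs FP]]] := hs by0.
have hG : metric_on V G by exact: loc_metric_sub.
have [E Es Eo] := exists_smooth_frame hG.
have [c uE] : exists c, u = c *m F (y0 x).
  have [_ D] := FP _ Vy; move: su; rewrite -loc_dist_base D => /submxP[c ->].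
  by exists c.
have Xs : smooth_on V (fun z => c *m F z).
  by apply: (smooth_mulmx oV) => //; exact: (smooth_cst oV).
have Xd z : V z -> loc_dist sigma b z (c *m F z).
  by move=> Vz; have [_ ->] := FP z Vz; exact: submxMl.
have ov' : orth (G (y0 x)) (loc_dist sigma b (y0 x)) v.
  by rewrite /G loc_metric_base loc_dist_base.
have RE a : Rie G (y0 x) u v (E a (y0 x)) = 0.
  by rewrite uE; exact: (vlift_curv_frame_eq0 oV Vi Es Eo Xs Xd a H Vy ov').
rewrite /curvature RieE -/G -/(y0 x).
(* Orthonormality makes this matrix invertible, so every [w] is a combination of frame vectors, on
   which R(u, v) is already known to vanish. *)
pose Mx := \matrix_a E a (y0 x).
have : Mx *m (G (y0 x) *m Mx^T) = 1%:M.
  apply/matrixP => a a'; rewrite mulmxA [RHS]mxE -(Eo _ Vy) /ip.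
  rewrite -[E a _](rowK (E^~ (y0 x))).
  rewrite -[E a' _](rowK (E^~ (y0 x))) -/Mx -row_mul [LHS]mxE [RHS]mxE.
  by apply: eq_bigr => l _; rewrite !mxE.
move=> /mulmx1_unit[Mu _].
rewrite -[w](mulmxKV Mu) mulmx_sum_row.
elim/big_rec : _ => [|a t _ t0]; first by rewrite (Rie0r hG).
by rewrite (Rie_linr hG)// rowK RE scaler0 t0 addr0.
Qed.

(** A nonzero [u] in sigma, which exists by positive rank, and a nonzero [v] orthogonal to sigma, at
    a point where sigma is not the whole tangent space, span a plane. As R(u, v) = 0, its sectional
    curvature is zero. *)
Lemma vlift_not_harmonic kappa : (1 <= k)%N -> (exists x, sigma x <> setT) ->
  kappa != 0 -> constant_sectional A g kappa ->
  ~ harmonic_distribution TA (sasaki A g) (vlift_dist sigma).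
Proof.
move=> k1 [x sxT] kap0 K H.
have by0 := base_img x; have Vi : img (base A x) `<=` img (base A x) by [].
have oi : open (img (base A x)) by exact: (mfd_img_open hM).
have hG := loc_metric_sub oi Vi; have hd := loc_dist_on oi Vi.
have [u su u0] : exists2 u, sigma x u & u != 0.
  have [V [F [_ Vy _ _ /(_ _ Vy)[Ff D]]]] := hs by0.
  exists (row (Ordinal k1) (F (y0 x))).
    by rewrite -loc_dist_base D /=; exact: row_sub.
  apply/eqP => r0; have : delta_mx 0 (Ordinal k1) = 0 :> 'rV[R]_k.
    by apply: (row_free_inj Ff); rewrite -rowE r0 mul0mx.
  by move=> /rowP/(_ (Ordinal k1)); rewrite !mxE !eqxx => /eqP; rewrite oner_eq0.
have [v ov v0] : exists2 v, orth (g x) (sigma x) v & v != 0.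
  (* Subtracting from a vector outside sigma its projection leaves a nonzero orthogonal vector. *)
  have [w sw] : exists w, ~ sigma x w.
    by apply: contrapT => /forallNP sw; apply: sxT; apply/seteqP; split=> // w _;
      exact: contrapT (sw w).
  have := orth_projection hG hd w by0; rewrite loc_metric_base loc_dist_base.
  move=> [sp op]; exists (w - oproj (g x) (sigma x) w) => //.
  by apply/eqP => /subr0_eq wE; apply: sw; rewrite wE.
have uv : ip (g x) u v = 0.
  by rewrite (ipC _ _ (riem_sym hg x)) ov.
(* Pairing a linear relation with [v] and then with [u] kills both coefficients, by
   orthogonality. *)
have free : row_free (col_mx u v).
  rewrite -kermx_eq0; apply/eqP/row_matrixP => i; rewrite row0.
  set r := row i _.
  have /sub_kermxP : (r <= kermx (col_mx u v))%MS by exact: row_sub.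
  rewrite -[r]hsubmxK mul_row_col.
  rewrite [lsubmx r]mx11_scalar [rsubmx r]mx11_scalar !mul_scalar_mx.
  move: (lsubmx r 0 0) (rsubmx r 0 0) => a b E.
  have := congr1 (ip (g x) u) E; have := congr1 (ip (g x) v) E.
  rewrite !ipDr !ipZr uv (ipC v u (riem_sym hg x)) uv !ip0r !mulr0 addr0 add0r.
  have pos t : t != 0 -> ip (g x) t t != 0.
    by move=> t0; rewrite gt_eqF// (riem_pos hg).
  move=> /eqP; rewrite mulf_eq0 (negbTE (pos v v0)) orbF => /eqP ->.
  move=> /eqP; rewrite mulf_eq0 (negbTE (pos u u0)) orbF => /eqP ->.
  by rewrite raddf0 row_mx0.
have := K x u v free; rewrite /sectional (vlift_curvature v H su ov) ip0l mul0r.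
by move=> /esym kE; rewrite kE eqxx in kap0.
Qed.

End Harmonic.

Theorem corollary3p3 (R : realType) (n p : nat) (M : topologicalType)
    (A : atlas R n M) (g : M -> 'M[R]_n) (sigma : M -> set 'rV[R]_n)
    (hM : smooth_manifold A) (hg : riemannian A g)
    (hsigma : smooth_distribution A p sigma) (hp : (1 <= p)%N)
    (hneq : exists x, sigma x <> setT) :
  [/\ harmonic_distribution (tangent_atlas A) (sasaki A g) (hlift_dist A g sigma) ->
        harmonic_distribution A g sigma,
      harmonic_distribution (tangent_atlas A) (sasaki A g) (vlift_dist sigma) ->
        harmonic_distribution A g sigma /\
        (forall x u v, sigma x u -> orth (g x) (sigma x) v ->
           forall w, curvature A g x u v w = 0) &
      forall kappa : R, kappa != 0 -> constant_sectional A g kappa ->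
        ~ harmonic_distribution (tangent_atlas A) (sasaki A g) (vlift_dist sigma)].
Proof.
split=> [H|H|kappa kappa0 K].
- exact: (harmonic_of_hlift hM hg hsigma H).
- split; first exact: (harmonic_of_vlift hM hg hsigma H).
  by move=> x u v su ov w; exact: (vlift_curvature hM hg hsigma w H su ov).
- exact: (vlift_not_harmonic hM hg hsigma hp hneq kappa0 K).
Qed.
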